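(* Let $r \geq 2$, let $H$ be a graph that is either $3$-connected or equal to $K_3$, and let $G_1,\dots,G_r$ be an $H$-free colour pattern on a vertex set $V$. Then there exists a graph $G$ containing the graph $(V, E(G_1)\cup\dots\cup E(G_r))$ as an induced subgraph such that $G \not\rightarrow (H)_r$, and such that in every $r$-colouring of $E(G)$ without a monochromatic copy of $H$, each $G_i$ is monochromatic (all its edges receive the same colour) and no two distinct $G_i$, $G_j$ are monochromatic in the same colour.
   Context: All graphs are finite and simple. $G \rightarrow (H)_r$ means every colouring of the edges of $G$ with $r$ colours contains a monochromatic copy of $H$; $G \not\rightarrow (H)_r$ is its negation. A colour pattern on a vertex set $V$ is a sequence $G_1,\dots,G_r$ of pairwise edge-disjoint graphs all having vertex set $V$; it is $H$-free if no $G_i$ contains $H$ as a subgraph. *)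

(* Defs.v *)
From mathcomp Require Import all_boot.
Set Implicit Arguments. Unset Strict Implicit. Unset Printing Implicit Defensive.

Definition is_sgraph (T : finType) (e : rel T) : Prop :=
  irreflexive e /\ symmetric e.

Definition copy_in (U T : finType) (h : rel U) (e : rel T) : Prop :=
  exists f : U -> T, injective f /\ forall x y, h x y -> e (f x) (f y).

(* an r-colouring of the edges of a graph on T: a symmetric colour function
   (its values on non-edges are irrelevant) *)
Definition is_colouring (r : nat) (T : finType) (c : T -> T -> 'I_r) : Prop :=
  forall x y, c x y = c y x.

Definition colour_class (r : nat) (T : finType) (e : rel T) (c : T -> T -> 'I_r)
  (i : 'I_r) : rel T := fun x y => e x y && (c x y == i).

Definition has_mono_copy (r : nat) (U T : finType) (h : rel U) (e : rel T)
  (c : T -> T -> 'I_r) : Prop :=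
  exists i : 'I_r, copy_in h (colour_class e c i).

Definition arrows (r : nat) (U T : finType) (h : rel U) (e : rel T) : Prop :=
  forall c : T -> T -> 'I_r, is_colouring c -> has_mono_copy h e c.

Definition connected_minus (U : finType) (h : rel U) (S : {set U}) : Prop :=
  forall x y, x \notin S -> y \notin S ->
    connect [rel a b | h a b && (a \notin S) && (b \notin S)] x y.

Definition k_connected (k : nat) (U : finType) (h : rel U) : Prop :=
  k < #|U| /\ forall S : {set U}, #|S| < k -> connected_minus h S.

Definition is_K3 (U : finType) (h : rel U) : Prop :=
  #|U| = 3 /\ forall x y, h x y = (x != y).

Definition colour_pattern (r : nat) (V : finType) (Gs : 'I_r -> rel V) : Prop :=
  (forall i, is_sgraph (Gs i)) /\
  (forall i j x y, i != j -> Gs i x y -> Gs j x y -> False).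

Definition pattern_H_free (r : nat) (U V : finType) (h : rel U)
  (Gs : 'I_r -> rel V) : Prop :=
  forall i, ~ copy_in h (Gs i).

Definition pattern_union (r : nat) (V : finType) (Gs : 'I_r -> rel V) : rel V :=
  fun x y => [exists i, Gs i x y].

(* Main.v *)
Require Import Defs.
From mathcomp Require Import all_boot.
From mathcomp Require Import perm zify.
From Stdlib Require Import Classical.

(* Remove one edge [xz] from an edge-minimal Ramsey graph of [h]: in every good colouring (one without
   monochromatic copy of [h]) of the remaining graph [G], all [r] colours occur at [x].  Glue copies of [G]
   along [x] and its neighbours, following a hypergraph that is not [r]-colourable and locally a forest.
   The result arrows [h], while the copies that share only [x] do not, so some single identification of
   two neighbours [p], [q] of [x] destroys all good colourings.  As [p] and [q] are far apart outside [x]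
   and [h] stays connected after the removal of two vertices, this identification creates no copy of [h];
   hence [xp] and [xq] differ in every good colouring.  Attaching such gadgets to a caterpillar gives two
   distant edges with the same property; these in turn are attached to the pattern together with one
   reference edge per colour, between each edge and the reference edges of all other colours. *)

Set Implicit Arguments. Unset Strict Implicit. Unset Printing Implicit Defensive.

(** * Colourings and well connected graphs *)

(** Common ground of the two hypotheses on [h]: the bound [2 < #|U|] admits [K_3], and deleting two
    vertices still leaves [h] connected. *)
Definition well_connected (U : finType) (h : rel U) : Prop :=
  [/\ is_sgraph h, 2 < #|U| &
      forall S : {set U}, #|S| < 3 -> connected_minus h S].

Definition good (r : nat) (U T : finType) (h : rel U) (e : rel T)
    (c : T -> T -> 'I_r) : Prop :=
  is_colouring c /\ ~ has_mono_copy h e c.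

Lemma not_arrows_good r (U T : finType) (h : rel U) (e : rel T) :
  ~ arrows r h e <-> exists c : T -> T -> 'I_r, good h e c.
Proof.
split=> [|[c [cC cN]] A]; last exact/cN/A.
move=> nA; apply: NNPP => nE; apply: nA => c cC.
by apply: NNPP => nM; apply: nE; exists c.
Qed.

Lemma good_pullback r (U T1 T2 : finType) (h : rel U) (e1 : rel T1)
    (e2 : rel T2) (g : T1 -> T2) (c : T2 -> T2 -> 'I_r) :
  injective g -> (forall x y, e1 x y -> e2 (g x) (g y)) ->
  good h e2 c -> good h e1 (fun x y => c (g x) (g y)).
Proof.
move=> gI gE [cC cN]; split=> [x y|[i [f [fI fE]]]]; first exact: cC.
apply: cN; exists i, (g \o f); split=> [|x y /fE]; first exact: inj_comp.
by case/andP=> /gE ge ci; apply/andP.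
Qed.

Lemma pigeonhole (T I : finType) (f : T -> I) (A : {set T}) m :
  #|I| * m < #|A| -> exists k, m < #|[set x in A | f x == k]|.
Proof.
move=> lt; apply: NNPP => nE; move: lt; rewrite ltnNge => /negP; apply.
rewrite -sum1_card (partition_big f predT) //= -sum_nat_const.
apply: leq_sum => k _; rewrite leqNgt; apply/negP => lt; apply: nE.
by exists k; rewrite -sum1_card; under eq_bigl do rewrite inE.
Qed.

Section WellConnected.
Variables (U : finType) (h : rel U).
Hypothesis hW : well_connected h.

Lemma closed_all (S : {set U}) (P : pred U) :
  #|S| < 3 ->
  (forall u v, h u v -> u \notin S -> v \notin S -> P u -> P v) ->
  forall u v, u \notin S -> v \notin S -> P u -> P v.
Proof.
case: hW => _ _ conn S3 cl u v uS vS Pu.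
have /connectP[p pp ->] := conn S S3 u v uS vS.
elim: p u {uS} Pu pp => //= w p IH u Pu /andP[/andP[/andP[huw uS] wS] pp].
exact: IH (cl _ _ huw uS wS Pu) pp.
Qed.

(** Otherwise deleting the only neighbour, if there is one, would isolate [u] while a further vertex
    remains. *)
Lemma two_nbrs u : exists v w, [/\ v != w, h u v & h u w].
Proof.
have [_ U3 _] := hW.
have nbr (S : {set U}) : #|S| < 2 -> u \notin S -> exists2 v, v \notin S & h u v.
  move=> S2 uS; apply: NNPP => nE.
  have /subsetPn[w _] : ~~ ([set: U] \subset u |: S).
    by apply/negP => /subset_leq_card; rewrite cardsT cardsU1 uS; lia.
  rewrite !inE negb_or => /andP[wu wS].
  suff /eqP : w == u by apply/eqP.
  apply: (@closed_all S (pred1 u)) (uS) (wS) _ => /=; [lia| |exact/eqP].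
  move=> a b hab _ bS /eqP au; case: nE; exists b => //; by rewrite -au.
have [v _ huv] : exists2 v, v \notin set0 & h u v by apply: nbr; rewrite ?cards0 ?inE.
have [[irr _] _ _] := hW.
have [w] : exists2 w, w \notin [set v] & h u w.
  by apply: nbr; rewrite ?cards1 ?inE //; apply: contraTneq huv => ->; rewrite irr.
by rewrite inE => wv huw; exists v, w; split; rewrite // eq_sym.
Qed.

Lemma some_edge : exists u v, h u v.
Proof.
have [_ U3 _] := hW.
have /card_gt0P[u _] : 0 < #|U| by lia.
by have [v [w []]] := two_nbrs u; exists u, v.
Qed.

Lemma good_recolour r (T : finType) (e : rel T) (c : T -> T -> 'I_r)
    (s : 'I_r -> 'I_r) :
  injective s -> good h e c -> good h e (fun x y => s (c x y)).
Proof.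
move=> sI [cC cN]; split=> [x y|[i [f [fI fE]]]]; first by rewrite cC.
have [u [v huv]] := some_edge; apply: cN.
have /andP[_ /eqP si] := fE _ _ huv.
exists (c (f u) (f v)), f; split=> // x y /fE /andP[exy /eqP sxy].
by rewrite /colour_class exy; apply/eqP/sI; rewrite sxy si.
Qed.

End WellConnected.

Lemma inj_two_points r (a b i j : 'I_r) :
  a != b -> i != j -> exists s : 'I_r -> 'I_r, [/\ injective s, s a = i & s b = j].
Proof.
move=> ab ij; exists (tperm a i * tperm (tperm a i b) j)%g; split.
- exact: perm_inj.
- rewrite permM tpermL tpermD // eq_sym; last by [].
  by rewrite -{1}(tpermL a i) (inj_eq perm_inj).
- by rewrite permM tpermL.
Qed.

(** * A graph in which all colours occur at one vertex *)

(* Greedy end-homogeneous sequence: the colour of a pair depends only on its first vertex, recorded as a label. *)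
Lemma end_homogeneous r (T : finType) (c : T -> T -> 'I_r) L (A : {set T}) :
  r.+1 ^ L <= #|A| ->
  exists2 s : seq (T * 'I_r), size s = L &
    all (fun a => a.1 \in A) s /\
    pairwise (fun a b => (a.1 != b.1) && (c a.1 b.1 == a.2)) s.
Proof.
elim: L A => [|L IH] A lA; first by exists [::].
have /card_gt0P[v vA] : 0 < #|A| by apply: leq_trans lA; rewrite expn_gt0.
(* The base [r.+1] pays for the removal of [v]: some colour class of [A :\ v] still has [r.+1 ^ L]
   elements. *)
have [|k lk] := @pigeonhole T 'I_r (c v) (A :\ v) (r.+1 ^ L).-1.
  move: lA; rewrite card_ord (cardsD1 v A) vA expnS.
  have : 0 < r.+1 ^ L by rewrite expn_gt0.
  case: (r.+1 ^ L) => // m _ /=; rewrite add1n mulSn mulnS; have := ltn_ord (c v v); lia.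
have [|s sL [/allP sA sp]] := IH [set x in A :\ v | c v x == k].
  by move: lk; case: (r.+1 ^ L).
exists ((v, k) :: s); first by rewrite /= sL.
rewrite /= vA sp andbT; split; apply/allP => a /sA; rewrite !inE /=.
  by case/andP=> /andP[].
by rewrite eq_sym => /andP[/andP[-> _]].
Qed.

(** In a complete graph, an end-homogeneous sequence of length [r * #|U|] carries some label [#|U|]
    times, and the vertices with that label span a monochromatic clique. *)
Lemma ramsey r (U : finType) (h : rel U) :
  irreflexive h -> 0 < r ->
  exists (T : finType) (e : rel T), is_sgraph e /\ arrows r h e.
Proof.
move=> hI r0; pose T := 'I_(r.+1 ^ (r * #|U|)).
exists T, (fun x y => x != y).
split; first by split=> [x|x y]; rewrite ?eqxx // eq_sym.
move=> c cC; have [|s sL [_ sp]] := @end_homogeneous r T c (r * #|U|) setT.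
  by rewrite cardsT card_ord.
have [k lk] : exists k : 'I_r, #|U| <= count (fun a => a.2 == k) s.
  apply: NNPP => nE.
  have cs : \sum_(k < r) count (fun a => a.2 == k) s = size s.
    elim: s {sL sp nE} => [|a s IH] /=; first by rewrite big1.
    rewrite big_split /= IH -[RHS]add1n; congr (_ + _).
    by rewrite (bigD1 a.2) //= eqxx big1 // => k /negPf; rewrite eq_sym => ->.
  have lt k : count (fun a : T * 'I_r => a.2 == k) s < #|U|.
    by rewrite ltnNge; apply/negP => le; apply: nE; exists k.
  have U0 : 0 < #|U| by apply: leq_trans (lt (Ordinal r0)).
    have : \sum_(k < r) count (fun a => a.2 == k) s <= \sum_(k < r) #|U|.-1.
    by apply: leq_sum => k _; rewrite -ltnS prednK.
  rewrite cs sL sum_nat_const card_ord.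
  by case: #|U| U0 => // u _ /=; rewrite mulnS; lia.
pose s' := [seq a <- s | a.2 == k].
have sp' : pairwise (fun a b : T * 'I_r => (a.1 != b.1) && (c a.1 b.1 == k)) s'.
  have : pairwise (fun a b => (a.1 != b.1) && (c a.1 b.1 == a.2)) s'.
    by apply: subseq_pairwise sp; apply: filter_subseq.
  apply: (sub_in_pairwise (P := [pred a | a.2 == k])).
    by move=> a b; rewrite !inE => /eqP ak _ /=; rewrite ak.
  by apply/allP => a; rewrite mem_filter => /andP[].
have [u0|Ue] := pickP U; last first.
  have f (u : U) : T by have := Ue u.
  by exists k, f; split=> [u|u]; have := Ue u.
have a0 : T * 'I_r.
  have U0 : 0 < #|U| by apply/card_gt0P; exists u0.
  by move: lk U0; case: (s) => [|a _ _ _]; [rewrite /= ltnNge => -> | exact: a].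
pose f (u : U) := (nth a0 s' (enum_rank u)).1.
have rs (u : U) : enum_rank u < size s'.
  by have := leq_trans (ltn_ord (enum_rank u)) lk; rewrite size_filter.
have fp (u v : U) : enum_rank u < enum_rank v -> (f u != f v) && (c (f u) (f v) == k).
  by move/(pairwiseP a0): sp' => sp' uv; apply: (sp' _ _ _ _ uv); rewrite inE.
have fs (u v : U) : u != v -> (f u != f v) && (c (f u) (f v) == k).
  move=> uv; have [lt|lt|/val_inj/enum_rank_inj eq] := ltngtP (enum_rank u) (enum_rank v).
  - exact: fp.
  - by rewrite eq_sym cC; apply: fp.
  - by rewrite eq eqxx in uv.
exists k, f; split=> [u v fuv|u v huv].
  by apply/eqP; apply: contraT => /fs; rewrite fuv eqxx.
by apply: fs; apply: contraTneq huv => ->; rewrite hI.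
Qed.

(* In an edge-minimal Ramsey graph remove one edge [xz]: a colour missing at [x] could be given to [xz],
   because a monochromatic copy through [x] uses at least two edges there. *)
Lemma star_all_colours r (U : finType) (h : rel U) :
  0 < r -> well_connected h ->
  exists (T : finType) (e : rel T) (x : T),
    [/\ is_sgraph e, ~ arrows r h e &
        forall c : T -> T -> 'I_r, good h e c ->
          forall i, exists2 y, e x y & c x y = i].
Proof.
move=> r0 hW; have [[hI hS] U3 _] := hW.
have [T [e0 [e0S e0A]]] := ramsey hI r0.
pose m := fun e : rel T => #|[set p : T * T | e p.1 p.2]|.
have [e [eS eA eM]] : exists e : rel T, [/\ is_sgraph e, arrows r h e &
    forall e' : rel T, is_sgraph e' -> m e' < m e -> ~ arrows r h e'].
  move: {2}(m e0).+1 (ltnSn (m e0)) => k; elim: k e0 e0S e0A => // k IH e eS eA lk.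
  have [[e' [e'S lt e'A]]|nE] := classic
     (exists e' : rel T, [/\ is_sgraph e', m e' < m e & arrows r h e']).
    by apply: (IH e') => //; lia.
  by exists e; split=> // e' e'S lt e'A; apply: nE; exists e'.
have [eI eC] := eS.
have [x [z exz]] : exists x z, e x z.
  have [i [f [_ fE]]] := eA (fun _ _ => Ordinal r0) (fun _ _ => erefl).
  by have [u [v /fE /andP[euv _]]] := some_edge hW; exists (f u), (f v).
pose g := fun a b => e a b && ((a, b) != (x, z)) && ((a, b) != (z, x)).
have gS : is_sgraph g.
  split=> [a|a b]; first by rewrite /g eI.
  rewrite /g eC !xpair_eqE -!andbA; congr (_ && _).
  by rewrite andbC ![(a == _) && _]andbC.
exists T, g, x; split=> //.
  apply: eM => //; apply: proper_card; apply/properP; split.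
    by apply/subsetP => p; rewrite !inE => /andP[/andP[]].
  by exists (x, z); rewrite !inE //= /g exz eqxx.
move=> c [cC cN] i; apply: NNPP => nE.
pose xz a b := ((a, b) == (x, z)) || ((a, b) == (z, x)).
have xzC a b : xz a b = xz b a by rewrite /xz !xpair_eqE orbC ![(a == _) && _]andbC.
pose c' a b := if xz a b then i else c a b.
have c'C : is_colouring c' by move=> a b; rewrite /c' xzC cC.
have [j [f [fI fE]]] := eA c' c'C; apply: cN.
exists j, f; split=> // a b hab; have /andP[eab /eqP cab] := fE a b hab.
suff nxz : xz (f a) (f b) = false.
  have cj : c (f a) (f b) = j by move: cab; rewrite /c' nxz.
  by move/negbT: nxz; rewrite /xz negb_or /colour_class /g eab cj eqxx andbT.
suff main u v : h u v -> (f u, f v) <> (x, z).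
  apply/negP => /orP[/eqP eq|/eqP[fa fb]]; first exact: main hab eq.
  by apply: (main b a); rewrite ?fa ?fb // hS.
move=> huv [fu fv]; apply: nE.
have ij : j = i by have /andP[_ /eqP <-] := fE _ _ huv; rewrite fu fv /c' /xz eqxx.
have [w huw wv] : exists2 w, h u w & w != v.
  have [w1 [w2 [w12 h1 h2]]] := two_nbrs hW u.
  by have [w1v|] := eqVneq w1 v; [exists w2; rewrite // -w1v eq_sym | exists w1].
have /andP[euw /eqP cuw] := fE _ _ huw.
have nz : f w != z by rewrite -fv (inj_eq fI).
have nx : x != z by apply: contraTneq exz => ->; rewrite eI.
exists (f w); first by move: euw; rewrite fu /g !xpair_eqE (negPf nz) (negPf nx) !andbF => ->.
by move: cuw; rewrite fu /c' /xz !xpair_eqE (negPf nz) (negPf nx) !andbF /= ij.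
Qed.

(** * Sparse hypergraphs of large chromatic number *)

(* A hypergraph is a family [g] of edges indexed by [J], whose vertices are labelled by [K].
   [A] is a leaf of [Q] when at most one of its labels is shared with the other members. *)
Definition leaf (J K Pt : finType) (g : J -> K -> Pt) (Q : {set J}) (A : J) :=
  forall B B' k k' l l', B \in Q -> B' \in Q -> B != A -> B' != A ->
    g A k = g B l -> g A k' = g B' l' -> k = k'.

(** Two leaves are required, as in a forest, so that one can be chosen different from a given
    member. *)
Definition sparse (J K Pt : finType) s (g : J -> K -> Pt) :=
  forall Q : {set J}, 1 < #|Q| <= s ->
    exists A B, [/\ A \in Q, B \in Q, A != B, leaf g Q A & leaf g Q B].

Definition unavoidable (J K Pt : finType) r (g : J -> K -> Pt) :=
  forall c : Pt -> 'I_r, exists A, forall k k', c (g A k) = c (g A k').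

Lemma injection_in_class (K : finType) r (C : 'I_(r * #|K|).+1 -> 'I_r) :
  exists f : {f : {ffun K -> 'I_(r * #|K|).+1} | injectiveb f},
    forall k k', C (val f k) = C (val f k').
Proof.
have [|i lt] := @pigeonhole _ _ C setT #|K|; first by rewrite cardsT !card_ord.
set X := [set x in setT | C x == i] in lt.
pose f := [ffun k : K => nth ord0 (enum X) (enum_rank k)].
have ltX (k : K) : enum_rank k < size (enum X).
  by rewrite -cardE; apply: ltn_trans lt.
have fI : injectiveb f.
  apply/injectiveP => k k'; rewrite !ffunE => /eqP.
  by rewrite nth_uniq ?enum_uniq // => /eqP/val_inj/enum_rank_inj.
have fX k : C (f k) = i.
  have : f k \in X by rewrite ffunE -mem_enum mem_nth.
  by rewrite !inE => /eqP.
by exists (exist _ f fI) => k k' /=; rewrite !fX.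
Qed.

(* Copies of [g], one for each edge of [gM], glued along the part [i] according to [gM]. *)
Definition amalgam (J K Pt JM PM I : finType) (g : J -> K -> Pt)
    (gM : JM -> Pt -> PM) (part : Pt -> I) (i : I) :
    J * JM -> K -> Pt * JM + PM :=
  fun A k => let p := g A.1 k in if part p == i then inr (gM A.2 p) else inl (p, A.2).

(** Distinct copies meet only in part [i], where a transversal edge has at most one point. A
    subfamily within one copy inherits leaves from [g]; if every copy holds one member, all members
    are leaves; otherwise fewer than [#|Q|] copies occur, [gM] gives two leaf copies, and each
    contains a leaf of [Q]. *)
Lemma sparse_amalgam (J K Pt JM PM I : finType) (g : J -> K -> Pt)
    (gM : JM -> Pt -> PM) (part : Pt -> I) (i : I) s :
  (forall A, injective (fun k => part (g A k))) -> (forall M, injective (gM M)) ->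
  sparse s.+1 g -> sparse s gM -> sparse s.+1 (amalgam g gM part i).
Proof.
move=> tr gMI spg spM Q /andP[Q1 Qs].
have same A B M k l : amalgam g gM part i (A, M) k = amalgam g gM part i (B, M) l ->
    g A k = g B l.
  by rewrite /amalgam /=; do 2!case: ifP => // _; case=> // /gMI.
have sameV A B M k l : g A k = g B l ->
    amalgam g gM part i (A, M) k = amalgam g gM part i (B, M) l.
  by rewrite /amalgam /= => ->.
have diff A M B M' k l : M != M' ->
    amalgam g gM part i (A, M) k = amalgam g gM part i (B, M') l ->
    part (g A k) = i /\ gM M (g A k) = gM M' (g B l).
  move=> nM; rewrite /amalgam /=; case: eqP => [->|_]; case: eqP => // _ []; first by [].
  by move=> _ eM; rewrite eM eqxx in nM.
pose QM M := [set A | (A, M) \in Q].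
pose R := [set x.2 | x in Q].
have inR A M : (A, M) \in Q -> M \in R by move=> AQ; apply/imsetP; exists (A, M).
have QMs M : #|QM M| <= s.+1.
  apply: leq_trans Qs; rewrite -(card_imset (QM M) (f := fun A => (A, M))); last by move=> ? ? [].
  by apply/subset_leq_card/subsetP => _ /imsetP[A + ->]; rewrite inE.
have single A M : (A, M) \in Q -> (forall B, (B, M) \in Q -> B = A) ->
    leaf (amalgam g gM part i) Q (A, M).
  move=> AQ sg [B M1] [B' M2] k k' l l' BQ BQ' nB nB'.
  have nM1 : M != M1 by apply: contraNneq nB => eM; rewrite -eM in BQ *; rewrite (sg _ BQ).
  have nM2 : M != M2 by apply: contraNneq nB' => eM; rewrite -eM in BQ' *; rewrite (sg _ BQ').
  move=> /(diff _ _ _ _ _ _ nM1)[p1 _] /(diff _ _ _ _ _ _ nM2)[p2 _].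
  by apply: (tr A); rewrite p1 p2.
(* If neither of two leaves of the copy [M] were a leaf of [Q], both would contain the unique point of [M]
   that is shared with other copies, so that this point would be their unique shared point. *)
have leafM M : M \in R -> leaf gM R M -> exists2 A, (A, M) \in Q &
    leaf (amalgam g gM part i) Q (A, M).
  move=> /imsetP[[A0 M0] AQ /= eM] lM; rewrite -{}eM in AQ => {M0}.
  have [Q2|Q1'] := ltnP 1 #|QM M|; last first.
    exists A0 => //; apply: single => // B BQ.
    by apply: (card_le1_eqP Q1'); rewrite inE.
  have [|A1 [A2 [A1Q A2Q A12 l1 l2]]] := spg (QM M); first by rewrite Q2 QMs.
  pose ext A k := exists B M' l, [/\ (B, M') \in Q, M' != M &
    amalgam g gM part i (A, M) k = amalgam g gM part i (B, M') l].
  have extP A k A' k' : ext A k -> ext A' k' -> g A k = g A' k'.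
    move=> [B [M1 [l [BQ n1 /(diff _ _ _ _ _ _)[|_ e1]]]]]; first by rewrite eq_sym.
    move=> [B' [M2 [l' [BQ' n2 /(diff _ _ _ _ _ _)[|_ e2]]]]]; first by rewrite eq_sym.
    by apply: lM e1 e2 => //; apply: inR; eassumption.
  have int A B k l : (B, M) != (A, M) -> amalgam g gM part i (A, M) k = amalgam g gM part i (B, M) l ->
      B != A /\ g A k = g B l.
    by move=> nB /same ->; split=> //; apply: contraNneq nB => ->.
  have noext A : A \in QM M -> leaf g (QM M) A -> (forall k, ~ ext A k) ->
      leaf (amalgam g gM part i) Q (A, M).
    move=> AQM lA nx [B M1] [B' M2] k k' l l' BQ BQ' nB nB' e1 e2.
    have eM1 : M1 = M by apply/eqP; apply: contraT => n; case: (nx k); exists B, M1, l.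
    have eM2 : M2 = M by apply/eqP; apply: contraT => n; case: (nx k'); exists B', M2, l'.
    subst M1 M2; have [n1 f1] := int _ _ _ _ nB e1; have [n2 f2] := int _ _ _ _ nB' e2.
    by apply: lA f1 f2 => //; rewrite inE.
  have [[k1 x1]|n1] := classic (exists k, ext A1 k); last first.
    exists A1; first by move: A1Q; rewrite inE.
    by apply: noext => // k x; apply: n1; exists k.
  have [[k2 x2]|n2] := classic (exists k, ext A2 k); last first.
    exists A2; first by move: A2Q; rewrite inE.
    by apply: noext => // k x; apply: n2; exists k.
  have e12 := extP _ _ _ _ x1 x2.
  exists A1; first by move: A1Q; rewrite inE.
  suff uniq k B M' l : (B, M') \in Q -> (B, M') != (A1, M) ->
      amalgam g gM part i (A1, M) k = amalgam g gM part i (B, M') l -> k = k1.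
    move=> [B M1] [B' M2] k k' l l' BQ BQ' nB nB' e1 e2.
    by rewrite (uniq _ _ _ _ BQ nB e1) (uniq _ _ _ _ BQ' nB' e2).
  move=> BQ nB e; have [eM|nM] := eqVneq M' M; last first.
    have xk : ext A1 k by exists B, M', l.
    by apply: (tr A1); rewrite (extP _ _ _ _ xk x1).
  subst M'; have [n f] := int _ _ _ _ nB e.
  by apply: l1 f e12 => //; rewrite ?inE // eq_sym.
have Rle : #|R| <= #|Q| := leq_imset_card _ _.
have [RQ|RQ] := eqVneq #|R| #|Q|.
  have /imset_injP pI : #|R| == #|Q| by apply/eqP.
  have sg x : x \in Q -> leaf (amalgam g gM part i) Q x.
    by case: x => A M AQ; apply: single => // B BQ; case: (pI _ _ AQ BQ erefl).
  have /card_gt1P[x [y [xQ yQ xy]]] := Q1.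
  by exists x, y; split=> //; apply: sg.
have [R1|R1] := leqP #|R| 1.
  have /card_gt1P[[A M] [y [AQ _ _]]] := Q1.
  have RM B M' : (B, M') \in Q -> M' = M.
    by move=> BQ; apply: (card_le1_eqP R1); apply: inR; eassumption.
  have QE : #|QM M| = #|Q|.
    rewrite -(card_imset (QM M) (f := fun A => (A, M))); last by move=> ? ? [].
    apply: eq_card => -[B M']; apply/imsetP/idP => [[B']|BQ]; first by rewrite inE => + [-> ->].
    by have E := RM _ _ BQ; subst M'; exists B; rewrite ?inE.
  have [|A1 [A2 [A1Q A2Q A12 l1 l2]]] := spg (QM M); first by rewrite QE Q1.
  have lf A' : A' \in QM M -> leaf g (QM M) A' -> leaf (amalgam g gM part i) Q (A', M).
    move=> AQ' lA [B M1] [B' M2] k k' l l' BQ BQ' nB nB'.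
    have E1 := RM _ _ BQ; have E2 := RM _ _ BQ'; subst M1 M2.
    move=> /same f1 /same f2; apply: lA f1 f2; rewrite ?inE //.
      by apply: contraNneq nB => ->.
    by apply: contraNneq nB' => ->.
  exists (A1, M), (A2, M); split; try exact: lf.
  - by move: A1Q; rewrite inE.
  - by move: A2Q; rewrite inE.
  - by apply: contraNneq A12 => -[->].
have [|M1 [M2 [M1R M2R M12 l1 l2]]] := spM R; first by rewrite R1; lia.
have [A1 A1Q lA1] := leafM _ M1R l1; have [A2 A2Q lA2] := leafM _ M2R l2.
by exists (A1, M1), (A2, M2); split=> //; apply: contraNneq M12 => -[_ ->].
Qed.

(* Partite construction of Nesetril and Rodl, by induction on [s]: amalgamate along each part in turn. *)
Lemma sparse_unavoidable r s (K : finType) :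
  0 < r -> exists (J Pt : finType) (g : J -> K -> Pt),
    [/\ forall A, injective (g A), unavoidable r g & sparse s g].
Proof.
move=> r0; elim: s K => [|s IH] K.
  pose J0 := {f : {ffun K -> 'I_(r * #|K|).+1} | injectiveb f}.
  exists J0, 'I_(r * #|K|).+1, (fun A : J0 => val A).
  split=> [A|c|Q]; first exact/injectiveP/(valP A).
    exact: injection_in_class.
  by case/andP=> q1; rewrite leqNgt (ltnW q1).
set a := (r * #|K|).+1; pose J0 := {f : {ffun K -> 'I_a} | injectiveb f}.
(* Every colouring admits a transversal copy of the family of all injections [K -> 'I_a] in which
   the colour of a point lying in a part from [I] depends on the part only. *)
have partite (I : seq 'I_a) : exists (J Pt : finType) (part : Pt -> 'I_a) (g : J -> K -> Pt),
    [/\ forall A, injective (fun k => part (g A k)), sparse s.+1 g &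
      forall c : Pt -> 'I_r, exists2 hj : J0 -> J,
        forall (A : J0) k, part (g (hj A) k) = val A k &
        forall (A : J0) k (A' : J0) k', val A k = val A' k' -> val A k \in I ->
          c (g (hj A) k) = c (g (hj A') k')].
  elim: I => [|i I [J [Pt [part [g [tr sp hc]]]]]].
    (* Start with pairwise disjoint edges. *)
    exists J0, (J0 * K)%type, (fun x : J0 * K => val x.1 x.2), (fun (A : J0) k => (A, k)).
    split=> [A||c]; first exact/injectiveP/(valP A).
      move=> Q /andP[/card_gt1P[A [B [AQ BQ AB]]] _].
      exists A, B; split=> // B1 B2 k k' l l' _ _ /eqP n _ [e]; by case: n.
    by exists id.
  have [JM [PM [gM [gMI gMu gMs]]]] := IH Pt.
  exists (J * JM)%type, (Pt * JM + PM)%type,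
    (fun p => match p with inl p => part p.1 | inr _ => i end), (amalgam g gM part i).
  have partE A k : match amalgam g gM part i A k with inl p => part p.1 | inr _ => i end =
      part (g A.1 k) by rewrite /amalgam /=; case: eqP.
  split=> [A k k'||c]; first by rewrite !partE => /tr.
    exact: sparse_amalgam.
  (* All points of part [i] in the copy [M] have the same colour; the induction hypothesis on [I] is
     then applied inside this copy. *)
  have [M mono] := gMu (fun q => c (inr q)).
  have [hj hjp hjc] := hc (fun p => c (if part p == i then inr (gM M p) else inl (p, M))).
  exists (fun A : J0 => (hj A, M)) => [A k|A k A' k' eA]; first by rewrite partE hjp.
  rewrite inE /amalgam /= !hjp -eA; case: eqP => [_ _|ni /= AI]; first exact: mono.
  by have := hjc _ _ _ _ eA AI; rewrite !hjp -eA; case: eqP.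
have [J [Pt [part [g [tr sp hc]]]]] := partite (enum 'I_a).
exists J, Pt, g; split=> // [A k k' e|c]; first by apply: (tr A); rewrite e.
have [hj _ hjc] := hc c.
pose C (i : 'I_a) := if [pick x : J0 * K | val x.1 x.2 == i] is Some x
  then c (g (hj x.1) x.2) else Ordinal r0.
have [f fC] := injection_in_class C.
have CE k : C (val f k) = c (g (hj f) k).
  rewrite /C; case: pickP => [x /eqP e|/(_ (f, k))/=]; last by rewrite eqxx.
  by apply: hjc => //; rewrite mem_enum.
by exists (hj f) => k k'; rewrite -!CE.
Qed.

(** * Merging two distant neighbours of a vertex *)

Lemma connect_invariant (T : finType) (e : rel T) (P : T -> Prop) a b :
  (forall u v, P u -> e u v -> P v) -> connect e a b -> P a -> P b.
Proof.
move=> cl /connectP[s sp ->]; elim: s a sp => //= v s IH a /andP[av sp] Pa.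
exact: IH sp (cl _ _ Pa av).
Qed.

Lemma card_preim_inj (T1 T2 : finType) (f : T1 -> T2) (A : {set T2}) :
  injective f -> #|[set u | f u \in A]| <= #|A|.
Proof.
move=> fI; rewrite -(card_imset _ fI); apply/subset_leq_card/subsetP => _ /imsetP[u + ->].
by rewrite inE.
Qed.

(** A bounded form of distance: no path outside [A :&: B] leads from one side to the other when at
    most [n] vertices beyond [A] and [B] are available. Taking [n] as [#|U|] suffices, since a copy
    of [h] has no more vertices. *)
Definition separated n (T : finType) (e : rel T) (A B : {set T}) :=
  forall (Z : {set T}) p q, #|Z| <= n -> p \in A :\: B -> q \in B :\: A ->
    let N := (Z :|: A :|: B) :\: (A :&: B) in
    ~~ connect [rel u v | e u v && (u \in N) && (v \in N)] p q.

Definition neq_gadget r (U T : finType) (h : rel U) (e : rel T) (a1 a2 b1 b2 : T) :=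
  [/\ is_sgraph e, e a1 a2 /\ e b1 b2, ~ arrows r h e,
      forall c : T -> T -> 'I_r, good h e c -> c a1 a2 <> c b1 b2 &
      separated #|U| e [set a1; a2] [set b1; b2]].

Section Merge.
Variables (U : finType) (h : rel U).
Hypothesis hW : well_connected h.

(* A copy of [h] through the merged vertex lies on one side of it once [x] and the merged vertex
   are deleted, hence lifts to the graph before merging. *)
Lemma merge_far r (T : finType) (e e' : rel T) (x p q : T) (c : T -> T -> 'I_r) :
  let rho v := if v == p then q else v in
  is_sgraph e -> e x p -> e x q -> p != q ->
  separated #|U| e [set x; p] [set x; q] ->
  (forall u v, e' u v -> exists a b, [/\ e a b, u = rho a & v = rho b]) ->
  good h e c -> c x p = c x q -> ~ arrows r h e'.
Proof.
move=> rho [eI eC] exp exq pq sep e'E [cC cN] cpq; apply/not_arrows_good.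
have [[hI hC] U3 _] := hW.
have xp : x != p by apply: contraTneq exp => ->; rewrite eI.
have xq : x != q by apply: contraTneq exq => ->; rewrite eI.
have [px qx qp] : [/\ p != x, q != x & q != p] by rewrite ![_ == x]eq_sym [q == p]eq_sym.
(* An edge at the merged vertex takes its colour from the endpoint, [p] or [q], that it came from;
   towards [x] both choices agree by assumption. *)
pose side v := if (v != x) && e p v then p else q.
pose c' u v := if u == q then c (side v) v else if v == q then c (side u) u else c u v.
exists c'; split=> [u v|[i [f [fI fE]]]].
  by rewrite /c'; do 2!case: eqP => ? //; subst.
have e'f u v : h u v -> e' (f u) (f v) by move/fE => /andP[].
have c'f u v : h u v -> c' (f u) (f v) = i by move/fE => /andP[_ /eqP].
have fp u : f u != p.
  have [v [_ [_ /e'f/e'E[a [_ [_ -> _]]] _]]] := two_nbrs hW u.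
  by rewrite /rho; case: (eqVneq a p) => // _; rewrite eq_sym.
have rhoE v a : v != p -> v != q -> v = rho a -> a = v.
  by rewrite /rho => _ /eqP nq; case: eqP.
have ef u v : h u v -> f u != q -> f v != q -> e (f u) (f v).
  move=> /e'f/e'E[a [b [eab fu fv]]] nu nv.
  by rewrite -(rhoE _ _ (fp u) nu fu) -(rhoE _ _ (fp v) nv fv).
have efq u v : h u v -> f u = q -> f v != q /\ (e p (f v) \/ e q (f v)).
  move=> huv fu; have nv : f v != q.
    by rewrite -fu (inj_eq fI); apply: contraTneq huv => ->; rewrite hI.
  split=> //; have [a [b [eab fua fv]]] := e'E _ _ (e'f _ _ huv).
  rewrite -(rhoE _ _ (fp v) nv fv); move: fua; rewrite fu /rho.
  by case: (eqVneq a p) eab => [-> ? _|_ + ->]; [left | right].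
(* It suffices to replace the merged vertex by [t], which is [p] or [q]. *)
have lift t : t \in [:: p; q] ->
    (forall u v, h u v -> f u = q -> e t (f v) /\ c t (f v) = i) -> False.
  move=> tpq tE; apply: cN; exists i, (fun u => if f u == q then t else f u).
  have tE' u v : h u v -> f u = q -> e t (f v) && (c t (f v) == i).
    by move=> huv fu; have [-> ->] := tE _ _ huv fu; rewrite eqxx.
  split=> [u v|u v huv].
    have nt w : f w != q -> f w != t.
      by move: tpq; rewrite !inE => /orP[]/eqP -> //; rewrite fp.
    case: (eqVneq (f u) q) => [fu|/nt/eqP nu]; case: (eqVneq (f v) q) => [fv|/nt/eqP nv].
    - by move=> _; apply: fI; rewrite fu.
    - by move=> eq; case: nv.
    - by move=> eq; case: nu.
    - exact: fI.
  rewrite /colour_class /=.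
  case: (eqVneq (f u) q) => [fu|nu]; case: (eqVneq (f v) q) => [fv|nv].
  - by have [/eqP] := efq _ _ huv fu; rewrite fv.
  - exact: tE' huv fu.
  - by rewrite eC cC; apply: (tE' v u) => //; rewrite hC.
  - rewrite ef //=; apply/eqP; have := c'f _ _ huv.
    by rewrite /c' (negPf nu) (negPf nv).
pose S := [set u | f u \in [set x; q]].
have S3 : #|S| < 3.
  apply: leq_ltn_trans (card_preim_inj _ fI) _; rewrite cards2; by case: (x != q).
have notS u : (u \notin S) = (f u != x) && (f u != q) by rewrite !inE negb_or.
set A := [set x; p] in sep; set B := [set x; q] in sep.
pose Z := [set f u | u : U]; pose N := (Z :|: A :|: B) :\: (A :&: B).
pose R := [rel u v | e u v && (u \in N) && (v \in N)].
have nCq : ~~ connect R p q.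
  apply: sep; first exact: leq_imset_card.
    by rewrite !inE eqxx orbT (negPf px) (negPf pq).
  by rewrite !inE eqxx orbT (negPf qx) (negPf qp).
have pN : p \in N by rewrite !inE eqxx (negPf px) (negPf pq) !orbT.
have qN : q \in N by rewrite !inE eqxx (negPf qx) (negPf qp) !orbT.
have fN u : f u != x -> f u \in N.
  move=> fu; rewrite !inE (negPf fu) /= (negPf (fp u)) /=.
  by rewrite imset_f.
have Cp u : f u != x -> e p (f u) -> connect R p (f u).
  by move=> fu epu; apply: connect1; rewrite /= epu pN fN.
have Cq u : f u != x -> e q (f u) -> ~~ connect R p (f u).
  move=> fu equ; apply: contra nCq => cu; apply: connect_trans cu (connect1 _).
  by rewrite /= eC equ qN fN.
have cl u v : h u v -> u \notin S -> v \notin S -> connect R p (f u) -> connect R p (f v).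
  rewrite !notS => huv /andP[ux uq] /andP[vx vq] cu.
  by apply: connect_trans cu (connect1 _); rewrite /= ef ?fN.
(* Outside [x] and the merged vertex the copy is connected: if it touches the side of [p] it lies
   there entirely and lifts with [p], otherwise it lifts with [q]. *)
have [[u0 u0S Cu0]|nC] := classic (exists2 u, u \notin S & connect R p (f u)).
  apply: (lift p); rewrite ?inE ?eqxx // => u v huv fu.
  have [vq epq] := efq _ _ huv fu.
  have cv := c'f _ _ huv; rewrite /c' fu eqxx /side in cv.
  have [vx|vx] := eqVneq (f v) x.
    by move: cv; rewrite vx eqxx /= eC (cC p) cpq (cC q).
  have epv : e p (f v).
    case: epq => // /(Cq _ vx)/negP[]; apply: (closed_all hW S3 cl u0S _ Cu0).
    by rewrite notS vx.
  by rewrite vx epv in cv.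
apply: (lift q); rewrite ?inE ?eqxx ?orbT // => u v huv fu.
have [vq epq] := efq _ _ huv fu.
have cv := c'f _ _ huv; rewrite /c' fu eqxx /side in cv.
have [vx|vx] := eqVneq (f v) x.
  by move: cv; rewrite vx eqxx /= eC.
have [epv|/negPf nepv] := boolP (e p (f v)).
  by case: nC; exists v; [rewrite notS vx | apply: Cp].
case: epq => [|eqv]; first by rewrite nepv.
by rewrite nepv andbF in cv.
Qed.

End Merge.

(** * Gluing copies of a graph at one vertex *)

Section Glue.
Variables (M J Pt : finType) (G : rel M) (x : M) (g : J -> M -> Pt).
Hypotheses (GS : is_sgraph G) (gI : forall A, injective (g A)).

(* Copies of [G] indexed by [J] share the vertex [x], which becomes [None]; the neighbour [m] of [x]
   in the copy [A] is identified with the point [g A m] when [(A, m) \in S], and is private otherwise. *)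
Definition glue_vertex (S : {set J * M}) (A : J) (m : M) : option (Pt + J * M) :=
  if m == x then None
  else if G x m && ((A, m) \in S) then Some (inl (g A m)) else Some (inr (A, m)).

Definition is_point (v : option (Pt + J * M)) := if v is Some (inl _) then true else false.

(* All edges from the centre to the points are present, so that both edges at the centre exist
   before two of its neighbours are merged. *)
Definition glued (S : {set J * M}) : rel (option (Pt + J * M)) := fun u v =>
  [|| [exists A, exists m, exists m',
         [&& G m m', u == glue_vertex S A m & v == glue_vertex S A m']],
      (u == None) && is_point v | (v == None) && is_point u].

Lemma gluedP S u v :
  reflect ((exists A m m', [/\ G m m', u = glue_vertex S A m & v = glue_vertex S A m'])
           \/ (u = None /\ is_point v) \/ (v = None /\ is_point u)) (glued S u v).
Proof.
apply: (iffP idP).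
  case/or3P => [/existsP[A /existsP[m /existsP[m' /and3P[? /eqP-> /eqP->]]]]||].
  - by left; exists A, m, m'.
  - by case/andP=> /eqP -> pv; right; left.
  - by case/andP=> /eqP -> pu; right; right.
case=> [[A [m [m' [Gm -> ->]]]]|[[-> pv]|[-> pu]]]; apply/or3P.
- by apply: Or31; apply/existsP; exists A; apply/existsP; exists m; apply/existsP; exists m'; rewrite Gm !eqxx.
- by apply: Or32; rewrite eqxx.
- by apply: Or33; rewrite eqxx.
Qed.

Lemma glue_vertex_inj S A : injective (glue_vertex S A).
Proof.
move=> m m'; rewrite /glue_vertex.
do 2!case: eqP => [->|_] //; do 2!case: ifP => _ //; by case=> // /gI.
Qed.

Lemma glue_vertex_shared S A B m m' : A != B -> m != x ->
  glue_vertex S A m = glue_vertex S B m' -> g A m = g B m'.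
Proof.
move=> /eqP AB; rewrite /glue_vertex => /negPf ->.
case: (m' == x); case: ifP => _ //; case: ifP => _ //; first by case.
by case=> /AB.
Qed.

Lemma glued_sgraph S : is_sgraph (glued S).
Proof.
have [GI GC] := GS; split=> [u|u v].
  apply/gluedP => -[[A [m [m' [Gm -> /glue_vertex_inj e]]]]|]; first by rewrite e GI in Gm.
  by case: u => [u|] [[]|[]].
by apply/gluedP/gluedP => -[[A [m [m' [Gm -> ->]]]]|[|]]; try tauto;
   left; exists A, m', m; rewrite GC.
Qed.

(** Colour each point by its edge to the centre: some copy of [G] then sees a single colour at [x],
    although at least two colours must occur there. *)
Lemma glued_full r (U : finType) (h : rel U) :
  1 < r -> unavoidable r g ->
  (forall c : M -> M -> 'I_r, good h G c -> forall i, exists2 y, G x y & c x y = i) ->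
  arrows r h (glued setT).
Proof.
have [GI _] := GS.
move=> r1 gU all_col; apply: NNPP => /not_arrows_good[c cg].
have [A mono] := gU (fun p => c None (Some (inl p))).
have col := all_col _ (good_pullback (@glue_vertex_inj setT A) _ cg).
have GE a b : G a b -> glued setT (glue_vertex setT A a) (glue_vertex setT A b).
  by move=> Gab; apply/gluedP; left; exists A, a, b.
have pt y : G x y -> glue_vertex setT A y = Some (inl (g A y)).
  move=> Gxy; rewrite /glue_vertex Gxy inE.
  by case: eqP => // e; rewrite e GI in Gxy.
have [y0 G0 c0] := col GE (Ordinal (ltnW r1)); have [y1 G1 c1] := col GE (Ordinal r1).
have ctr : glue_vertex setT A x = None by rewrite /glue_vertex eqxx.
by move: c0 c1; rewrite (pt _ G0) (pt _ G1) ctr (mono y0 y1) => -> [].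
Qed.

(** The copies of [G] are coloured alike. A point is adjacent to the centre only, so no copy of [h]
    uses it; and without the centre a copy of [h] stays connected, hence lies in one copy of [G]. *)
Lemma glued_empty r (U : finType) (h : rel U) :
  well_connected h -> ~ arrows r h G -> ~ arrows r h (glued set0).
Proof.
move=> hW /not_arrows_good[c [cC cN]]; apply/not_arrows_good.
have [GI GC] := GS.
pose c' (u v : option (Pt + J * M)) := match u, v with
  | Some (inr (A, m)), Some (inr (B, m')) => if A == B then c m m' else c x x
  | None, Some (inr (_, m)) | Some (inr (_, m)), None => c x m
  | _, _ => c x x end.
exists c'; split=> [|[i [f [fI fE]]]].
  move=> [[p|[A m]]|] [[p'|[B m']]|] //=.
  by rewrite eq_sym cC.
have gv A m : glue_vertex set0 A m = if m == x then None else Some (inr (A, m)).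
  by rewrite /glue_vertex inE andbF.
have edge u v : h u v -> [/\ glued set0 (f u) (f v) & c' (f u) (f v) = i].
  by move/fE => /andP[-> /eqP].
have inner u v : h u v -> ~~ is_point (f u).
  move=> huv; apply/negP => pu.
  have none w : h u w -> f w = None.
    move=> /edge[/gluedP + _]; case=> [[A [m [m' [_ fu _]]]]|[[fu _]|[]//]].
      by move: pu; rewrite fu gv; case: eqP.
    by rewrite fu in pu.
  have [w1 [w2 [/eqP n h1 h2]]] := two_nbrs hW u.
  by case: n; apply: fI; rewrite !none.
have [[_ hC] U3 _] := hW.
have copy u v : h u v -> exists A m m', [/\ G m m', f u = glue_vertex set0 A m &
    f v = glue_vertex set0 A m'].
  move=> huv; have [/gluedP + _] := edge _ _ huv; case=> // -[[_ pv]|[_ pu]].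
    by move: (inner v u); rewrite hC huv pv => /(_ erefl).
  by have := inner _ _ huv; rewrite pu.
pose proj (v : option (Pt + J * M)) := if v is Some (inr (_, m)) then m else x.
have projE A m : proj (glue_vertex set0 A m) = m by rewrite gv; case: eqP => [->|].
pose S := [set u | f u \in [set None]].
have S3 : #|S| < 3.
  by apply: leq_ltn_trans (card_preim_inj _ fI) _; rewrite cards1.
have notS u : (u \notin S) = (f u != None) by rewrite !inE.
have [u0 u0S] : exists u0, u0 \notin S.
  apply: NNPP => nE; suff : #|[set: U]| <= #|S| by rewrite cardsT; lia.
  by apply/subset_leq_card/subsetP => u _; apply: contraT => uS; case: nE; exists u.
have same u v : f u != None -> f v != None -> exists A, forall w, w \in [:: u; v] ->
    exists m, f w = glue_vertex set0 A m.
  move=> nu nv.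
  have [A [m fu]] : exists A m, f u = glue_vertex set0 A m.
    by have [v0 [_ [_ /copy[A [m [_ [_ -> _]]]] _]]] := two_nbrs hW u; exists A, m.
  pose P w := if f w is Some (inr (B, _)) then B == A else false.
  have PE w : P w -> exists m, f w = glue_vertex set0 A m.
    have [v0 [_ [_ /copy[B [m' [_ [_ fw _]]]] _]]] := two_nbrs hW w.
    rewrite /P fw gv; case: (eqVneq m' x) => // nx /eqP BA.
    by exists m'; rewrite gv (negPf nx) BA.
  exists A => w; rewrite !inE => /orP[]/eqP ->; first by exists m.
  apply: PE; apply: (closed_all hW S3 (P := P) _ (u := u)); rewrite ?notS //.
    move=> a b /copy[B [m1 [m2 [_ fa fb]]]]; rewrite !notS /P fa fb !gv.
    by case: (eqVneq m1 x) => // _; case: (eqVneq m2 x).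
  by move: nu; rewrite /P fu gv; case: (eqVneq m x).
apply: cN; exists i, (proj \o f); split=> [u v|u v huv] /=.
  have prx w : f w != None -> proj (f w) != x.
    have [v0 [_ [_ /copy[B [m' [_ [_ -> _]]]] _]]] := two_nbrs hW w.
    by rewrite gv; case: (eqVneq m' x).
  have [fu|nu] := eqVneq (f u) None; have [fv|nv] := eqVneq (f v) None.
  - by move=> _; apply: fI; rewrite fu.
  - by rewrite fu => e; have := prx _ nv; rewrite -e eqxx.
  - by rewrite fv => e; have := prx _ nu; rewrite e eqxx.
  - have [A AE] := same _ _ nu nv.
    have [|m fu] := AE u; first by rewrite inE eqxx.
    have [|m' fv] := AE v; first by rewrite !inE eqxx orbT.
    by rewrite fu fv !projE => e; apply: fI; rewrite fu fv e.
have [A [m [m' [Gm fu fv]]]] := copy _ _ huv.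
have [_] := edge _ _ huv; rewrite /colour_class fu fv !projE Gm /= !gv.
case: (eqVneq m x) => [mx|_]; case: (eqVneq m' x) => [mx'|_] //=.
- by rewrite mx mx' GI in Gm.
- by rewrite mx => /eqP.
- by rewrite mx' cC => /eqP.
- by rewrite eqxx => /eqP.
Qed.

(** Two vertices other than the centre are linked when they lie in a common copy from [Q], adjacent
    or not. *)
Definition link (S : {set J * M}) (Q : {set J}) : rel (option (Pt + J * M)) :=
  fun u v => [exists A in Q, exists m, exists m',
    [&& m != x, m' != x, u == glue_vertex S A m & v == glue_vertex S A m']].

Lemma linkP S (Q : {set J}) u v :
  reflect (exists A m m', [/\ A \in Q, m != x, m' != x, u = glue_vertex S A m &
    v = glue_vertex S A m']) (link S Q u v).
Proof.
apply: (iffP idP).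
  case/existsP=> A /andP[AQ /existsP[m /existsP[m' /and4P[? ? /eqP? /eqP?]]]].
  by exists A, m, m'.
case=> A [m [m' [AQ mx mx' -> ->]]]; apply/existsP; exists A; rewrite AQ /=.
by apply/existsP; exists m; apply/existsP; exists m'; rewrite mx mx' !eqxx.
Qed.

(* A leaf of [Q] other than [A0] meets the rest of [Q] in one point, so it can be dropped from any
   connection; when only [A0] is left there is none. *)
Lemma no_link (S : {set J * M}) A0 m0 s (Q : {set J}) :
  sparse s g -> m0 != x -> (A0, m0) \notin S -> #|Q| <= s -> A0 \in Q ->
  ~ connect (link S Q) (Some (inr (A0, m0))) (Some (inl (g A0 m0))).
Proof.
move=> sp m0x nS; set p := Some (inr _); set q := Some (inl _).
have gvp A m : glue_vertex S A m = p -> A = A0.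
  by rewrite /glue_vertex /p; do 2!case: ifP => // _; case.
have gvq A m : glue_vertex S A m = q -> (A, m) \in S /\ g A m = g A0 m0.
  by rewrite /glue_vertex /q; case: ifP => // _; case: ifP => // /andP[_ ->] [].
move: {2}#|Q| (erefl #|Q|) => n; elim: n Q => [|n IH] Q Qn Qs A0Q.
  by move/cards0_eq: Qn A0Q => ->; rewrite inE.
have [n0|n0] := posnP n.
  have /card_le1_eqP Q1' : #|Q| <= 1 by rewrite Qn n0.
  have Q1 B : B \in Q -> B = A0 by move=> BQ; apply: Q1'.
  move=> /(connect_invariant (P := fun v => exists m, v = glue_vertex S A0 m)) [].
  - by move=> u v _ /linkP[A [m [m' [/Q1 -> _ _ _ ->]]]]; exists m'.
  - by exists m0; rewrite /glue_vertex (negPf m0x) (negPf nS) andbF.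
  - by move=> m /esym/gvq[mS /gI m0E]; rewrite -m0E mS in nS.
have [A [AQ AA0 lA]] : exists A, [/\ A \in Q, A != A0 & leaf g Q A].
  have [|A [B [AQ BQ AB lA lB]]] := sp Q; first by rewrite Qn ltnS n0 -Qn.
  by have [e|] := eqVneq A A0; [exists B; rewrite -e eq_sym | exists A].
have A0Q' : A0 \in Q :\ A by rewrite !inE eq_sym AA0.
have Q'n : #|Q :\ A| = n by move: Qn; rewrite (cardsD1 A) AQ => -[].
have nC : ~ connect (link S (Q :\ A)) p q by apply: IH; rewrite ?Q'n //; lia.
(* A vertex of [A] reached through the other copies is shared with one of them; by the leaf property
   there is only one such vertex, so a detour through [A] comes back to where it began. *)
have far w m : m != x -> w = glue_vertex S A m -> connect (link S (Q :\ A)) p w ->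
    exists B l, [/\ B \in Q, B != A & g A m = g B l].
  move=> mx we /(connect_invariant (P := fun v => v = p \/
     exists B m, B \in Q :\ A /\ v = glue_vertex S B m)) [].
  - by move=> u v _ /linkP[B [m1 [m2 [BQ _ _ _ ->]]]]; right; exists B, m2.
  - by left.
  - by move=> e; case/eqP: AA0; apply: (gvp A m); rewrite -we.
  case=> B [m' []]; rewrite !inE => /andP[BA BQ] we'; exists B, m'; split=> //.
  by apply: (glue_vertex_shared (S := S) _ mx); [rewrite eq_sym | rewrite -we].
pose C := connect (link S (Q :\ A)) p.
(* Invariant: [v] is reached without [A], or lies in [A] together with a vertex [w] reached without
   [A]. *)
move=> /(connect_invariant (P := fun v => C v \/ exists m w m', [/\ m != x, m' != x, C w,
   v = glue_vertex S A m & w = glue_vertex S A m'])) [].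
- move=> u v Pu /linkP[B [m1 [m2 [BQ m1x m2x uE vE]]]].
  have step : B != A -> C u -> C v.
    move=> BA Cu; apply: connect_trans Cu (connect1 _); apply/linkP.
    by exists B, m1, m2; rewrite !inE BA BQ.
  case: Pu => [Cu|[m [w [m' [mx mx' Cw uE' wE]]]]].
    have [BA|/step] := eqVneq B A; last by move=> st; left; apply: st.
    by subst B; right; exists m2, u, m1.
  have [BA|BA] := eqVneq B A; first by subst B; right; exists m2, w, m'.
  left; apply: step => //.
  have [B' [l [B'Q B'A e']]] := far _ _ mx' wE Cw.
  have e : g A m = g B m1 by apply: (glue_vertex_shared (S := S) _ mx); [rewrite eq_sym | rewrite -uE'].
  by rewrite uE' (lA _ _ _ _ _ _ BQ B'Q BA B'A e e') -wE.
- by left; apply: connect0.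
- exact: nC.
case=> m [w [m' [mx mx' Cw qE wE]]]; have [_ e] := gvq _ _ (esym qE).
have [B' [l [B'Q B'A e']]] := far _ _ mx' wE Cw.
have mm : m = m' by apply: (lA _ _ _ _ _ _ A0Q B'Q _ B'A e e'); rewrite eq_sym.
by apply: nC; rewrite qE mm -wE.
Qed.

(* A path outside the centre through few vertices uses few copies. *)
Lemma glued_separated (S : {set J * M}) A0 m0 s :
  sparse s.+1 g -> m0 != x -> (A0, m0) \notin S ->
  separated s (glued S) [set None; Some (inr (A0, m0))] [set None; Some (inl (g A0 m0))].
Proof.
move=> sp m0x nS Z p0 q0 Zs; set p := Some (inr _); set q := Some (inl _).
move=> pP qP /=; set N := (_ :\: _).
have {pP} -> : p0 = p.
  by move: pP; rewrite !inE negb_or => /andP[/andP[/negPf -> _] /eqP].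
have {qP} -> : q0 = q.
  by move: qP; rewrite !inE negb_or => /andP[/andP[/negPf -> _] /eqP].
have NN u : u \in N -> u != None by rewrite !inE; case: eqP => // ->.
have Ns : #|N| <= s.+2.
  have : N \subset Z :|: [set p; q].
    apply/subsetP => u; rewrite !inE => /andP[+ /orP[/orP[->//|]|]]; last first.
      by case: (u == None) => //= _ ->; rewrite !orbT.
    by case: (u == None) => //= _ ->; rewrite !orbT.
  move/subset_leq_card/leq_trans; apply; apply: leq_trans (leq_card_setU _ _) _.
  by rewrite cards2; lia.
(* A path without repetition has at most [s.+2] vertices, hence at most [s.+1] edges, each inside
   one copy. *)
apply/negP => /connectP[t tp tq]; case/shortenP: tp tq => {}t tp tu _ tq.
have ts : size t <= s.+1.
  have [t0|t0] := posnP (size t); first by rewrite t0.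
  rewrite -ltnS; apply: leq_trans Ns; rewrite -[_.+1]/(size (p :: t)) -(card_uniqP tu).
  apply/subset_leq_card/subsetP => u; rewrite inE.
  have tN : {subset t <= N}.
    elim: (t) (p) tp => //= a t' IH b /andP[/andP[_ aN] /IH sub] c; rewrite inE.
    by case/orP=> [/eqP ->|/sub].
  case/orP=> [/eqP ->|/tN //].
  by case: (t) t0 tp => //= a t' _ /andP[/andP[/andP[_ pN] _] _].
have {tp tu} [Q Qs Qc] : exists2 Q : {set J}, #|Q| <= size t & connect (link S Q) p (last p t).
  elim: t (p) tp {tu tq ts} => [|a t IH] b /=.
    by exists set0; rewrite ?cards0.
  case/andP=> /andP[/andP[/gluedP gba bN] aN] /IH[Q Qs Qc].
  move: gba (NN _ bN) (NN _ aN); case=> [[A [m [m' [_ be ae]]]]|]; last first.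
    by case=> -[-> _].
  move=> nb na; have [mx m'x] : m != x /\ m' != x.
    split; [apply: contraNneq nb|apply: contraNneq na] => e;
    by rewrite ?be ?ae e /glue_vertex eqxx.
  exists (A |: Q); first by rewrite cardsU1 -add1n leq_add // leq_b1.
  apply: (@connect_trans _ _ a); first apply/connect1/linkP.
    by exists A, m, m'; split=> //; exact: setU11.
  apply: (connect_sub _ Qc) => u v /linkP[B [m1 [m2 [BQ ? ? ? ?]]]].
  by apply/connect1/linkP; exists B, m1, m2; split=> //; exact: setU1r.
have pq : p != q by [].
(* The vertex [p] is private to the copy [A0], so a path leaving it uses that copy. *)
have A0Q : A0 \in Q.
  apply: contraT => A0Q; move: Qc; rewrite -tq.
  move=> Qc; suff : q = p by [].
  apply: (connect_invariant (P := fun v => v = p) _ Qc) => // u v -> /linkP[A [m [_ [AQ _ _ + _]]]].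
  rewrite /p /glue_vertex; do 2!case: ifP => // _; case=> e _.
  by rewrite e AQ in A0Q.
by apply: (@no_link S A0 m0 s.+1 Q) => //; [apply: leq_trans Qs ts | rewrite -/p -/q tq].
Qed.

End Glue.

Lemma not_arrows_sub r (U T : finType) (h : rel U) (e1 e2 : rel T) :
  subrel e1 e2 -> ~ arrows r h e2 -> ~ arrows r h e1.
Proof.
move=> sub /not_arrows_good[c cg]; apply/not_arrows_good; exists c.
exact: (good_pullback (g := id) (@inj_id T) sub cg).
Qed.

(* Glue one incidence at a time, from a graph that does not arrow [h] to one that does:
   the critical merging must be between edges of different colours. *)
Lemma star_gadget r (U : finType) (h : rel U) :
  1 < r -> well_connected h ->
  exists (T : finType) (e : rel T) (x p q : T), neq_gadget r h e x p x q.
Proof.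
move=> r1 hW; have [M [G [x [GS Gc all_col]]]] := star_all_colours (ltnW r1) hW.
have [J [Pt [g [gI gU sp]]]] := sparse_unavoidable #|U|.+1 M (ltnW r1).
have [S nA [[A m] AmS yA]] : exists2 S : {set J * M}, ~ arrows r h (glued G x g S) &
    exists2 y, y \notin S & arrows r h (glued G x g (y |: S)).
  apply: NNPP => nE; suff H n (S : {set J * M}) : #|S| = n -> ~ arrows r h (glued G x g S).
    by apply: (H _ setT erefl); apply: glued_full.
  elim: n S => [|n IH] S.
    by move/cards0_eq ->; apply: glued_empty.
  move=> Sn SA; have /card_gt0P[y yS] : 0 < #|S| by rewrite Sn.
  apply: nE; exists (S :\ y); first by apply: IH; move: Sn; rewrite (cardsD1 y) yS => -[].
  by exists y; rewrite ?setD1K // !inE eqxx.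
have [GI GC] := GS.
(* If [m] were not a neighbour of [x], adding [(A, m)] would change nothing. *)
have Gxm : G x m.
  apply: contraT => nG; case: (not_arrows_sub _ nA yA).
  have gvE B m' : glue_vertex G x g ((A, m) |: S) B m' = glue_vertex G x g S B m'.
    rewrite /glue_vertex !inE; case: (m' == x) => //.
    by case: eqP => // -[-> ->]; rewrite (negPf nG).
  move=> u v /gluedP guv; apply/gluedP; case: guv => [[B [m1 [m2]]]|]; last by right.
  by rewrite !gvE; left; exists B, m1, m2.
have mx : m != x by apply: contraTneq Gxm => ->; rewrite GI.
pose p : option (Pt + J * M) := Some (inr (A, m)).
pose q : option (Pt + J * M) := Some (inl (g A m)).
have gvp : glue_vertex G x g S A m = p by rewrite /glue_vertex (negPf mx) (negPf AmS) andbF.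
have xp : glued G x g S None p.
  by apply/gluedP; left; exists A, x, m; rewrite gvp /glue_vertex eqxx.
have xq : glued G x g S None q by apply/gluedP; right; left.
have sepS := glued_separated G gI sp mx AmS.
exists _, (glued G x g S), None, p, q; split=> //; first exact: glued_sgraph.
move=> c cg e; apply: (merge_far hW _ xp xq _ sepS _ cg e yA) => //.
  exact: glued_sgraph.
move=> u v /gluedP[[B [m1 [m2 [Gm uE vE]]]]|uv]; last first.
  have fixed w : w = None \/ is_point w -> w = if w == p then q else w.
    by case: w => [[w|w]|] [].
  by exists u, v; split; [apply/gluedP; right | apply: fixed; tauto..].
have gvE m' : glue_vertex G x g ((A, m) |: S) B m' =
    if glue_vertex G x g S B m' == p then q else glue_vertex G x g S B m'.
  rewrite {1}/glue_vertex !inE; case: eqP => [->|/eqP nx].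
    by rewrite /glue_vertex eqxx.
  have [[-> ->]|n] := (B, m') =P (A, m); first by rewrite Gxm gvp eqxx.
  rewrite /= /glue_vertex (negPf nx); case: ifP => _ //.
  by case: eqP => // -[e1 e2]; case: n; rewrite e1 e2.
exists (glue_vertex G x g S B m1), (glue_vertex G x g S B m2).
by rewrite uE vE !gvE; split=> //; apply/gluedP; left; exists B, m1, m2.
Qed.

(** * Attaching gadgets to a graph *)

Section Attach.
Variables (r : nat) (U : finType) (h : rel U).
Hypothesis hW : well_connected h.
Variables (M : finType) (N : rel M) (a1 a2 b1 b2 : M).
Hypothesis gadget : neq_gadget r h N a1 a2 b1 b2.
Variables (V J : finType) (W : rel V) (glue : J -> M -> V).

Definition terminal (m : M) := m \in [set a1; a2] :|: [set b1; b2].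

(* The base graph [W] with a copy of the gadget for each [j], whose terminals are placed by [glue j];
   the vertices [inr (j, m)] with [m] a terminal are isolated. *)
Definition attached : rel (V + J * M) := fun u v =>
  match u, v with
  | inl a, inl b => W a b
  | inl a, inr (j, m) => ~~ terminal m && [exists t, [&& terminal t, glue j t == a & N t m]]
  | inr (j, m), inl a => ~~ terminal m && [exists t, [&& terminal t, glue j t == a & N t m]]
  | inr (j, m), inr (j', m') => [&& j == j', ~~ terminal m, ~~ terminal m' & N m m']
  end.

Definition embed j (m : M) : V + J * M := if terminal m then inl (glue j m) else inr (j, m).

Lemma attached_sgraph : is_sgraph W -> is_sgraph attached.
Proof.
have [[NI NC] _ _ _ _] := gadget.
move=> [WI WC]; split=> [[a|[j m]]|[a|[j m]] [b|[j' m']]] //=; first by rewrite NI !andbF.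
by rewrite eq_sym NC; case: eqP => //= _; rewrite andbCA.
Qed.

(** Separation with [Z] empty forbids an edge across. Hence edges among terminals can be identified
    with edges of [W]. *)
Lemma terminal_edge m m' : terminal m -> terminal m' -> N m m' ->
  (m \in [set a1; a2]) && (m' \in [set a1; a2]) || (m \in [set b1; b2]) && (m' \in [set b1; b2]).
Proof.
have [[NI NC] _ _ _ sep] := gadget.
have tE x : terminal x = (x \in [set a1; a2]) || (x \in [set b1; b2]) by rewrite -in_setU.
rewrite !{}tE; set A := [set a1; a2] in sep *; set B := [set b1; b2] in sep *.
suff main x y : ~~ [&& x \in A, x \notin B, y \in B, y \notin A & N x y].
  move=> + + Nmm; have := main m' m; have := main m m'.
  by rewrite (NC m') Nmm; do 4!case: (_ \in _).
apply/negP => /and5P[xA xB yB yA Nxy].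
have xAB : x \in A :\: B by rewrite in_setD xA xB.
have yBA : y \in B :\: A by rewrite in_setD yA yB.
have : #|set0 : {set M}| <= #|U| by rewrite cards0.
move/sep => /(_ x y xAB yBA) /negP[]; apply: connect1.
rewrite /= Nxy !(in_setD, in_setI) (negPf xB) (negPf yA) andbF /=.
by apply/andP; split; rewrite in_setU in_setU ?xA ?yB ?orbT.
Qed.

Hypotheses (glueI : forall j m m', terminal m -> terminal m' -> glue j m = glue j m' -> m = m').
Hypotheses (WS : is_sgraph W) (glueA : forall j, W (glue j a1) (glue j a2))
  (glueB : forall j, W (glue j b1) (glue j b2)).

Lemma terminals : [/\ terminal a1, terminal a2, terminal b1 & terminal b2].
Proof. by rewrite /terminal !inE !eqxx !orbT. Qed.

Lemma embed_inj j : injective (embed j).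
Proof.
move=> m m'; rewrite /embed; case: ifP => tm; case: ifP => tm' //.
  by case; apply: glueI.
by case.
Qed.

Lemma embed_edge j m m' : N m m' -> attached (embed j m) (embed j m').
Proof.
have [[NI NC] _ _ _ _] := gadget; have [_ WC] := WS.
move=> Nmm; rewrite /embed; case: ifP => tm; case: ifP => tm' /=; last 1 first.
- by rewrite eqxx tm tm' Nmm.
- have nmm : m != m' by apply: contraTneq Nmm => ->; rewrite NI.
  have := terminal_edge tm tm' Nmm; rewrite !inE => /orP[] /andP[/orP[]/eqP mE /orP[]/eqP mE'];
  by rewrite mE mE' ?eqxx // in nmm *; rewrite WC.
- by rewrite tm' /=; apply/existsP; exists m; rewrite tm eqxx.
- by rewrite tm /=; apply/existsP; exists m'; rewrite tm' eqxx NC.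
Qed.

Lemma attached_neq (c : V + J * M -> V + J * M -> 'I_r) j :
  good h attached c ->
  c (inl (glue j a1)) (inl (glue j a2)) <> c (inl (glue j b1)) (inl (glue j b2)).
Proof.
have [_ _ _ neq _] := gadget => cg.
have := neq _ (good_pullback (@embed_inj j) (@embed_edge j) cg).
by have [t1 t2 t3 t4] := terminals; rewrite /embed t1 t2 t3 t4.
Qed.

Section Colouring.
Variables (cW : V -> V -> 'I_r) (cN : J -> M -> M -> 'I_r) (i0 : 'I_r).
Hypotheses (cWg : good h W cW) (cNg : forall j, good h N (cN j)).
Hypotheses (cA : forall j, cN j a1 a2 = cW (glue j a1) (glue j a2))
  (cB : forall j, cN j b1 b2 = cW (glue j b1) (glue j b2)).

(** The default [i0] is used on non-edges only. *)
Definition attached_colour (u v : V + J * M) : 'I_r :=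
  let mixed a j m := if [pick t | terminal t && (glue j t == a)] is Some t then cN j t m else i0 in
  match u, v with
  | inl a, inl b => cW a b
  | inl a, inr (j, m) => mixed a j m
  | inr (j, m), inl a => mixed a j m
  | inr (j, m), inr (j', m') => if j == j' then cN j m m' else i0
  end.

Lemma attached_colour_sym : is_colouring attached_colour.
Proof.
have [cWC _] := cWg; move=> [a|[j m]] [b|[j' m']] //=.
by have [cNC _] := cNg j; rewrite eq_sym; case: eqP => // ->; rewrite cNC.
Qed.

Lemma attached_colour_mixed t j m : terminal t ->
  attached_colour (inl (glue j t)) (inr (j, m)) = cN j t m.
Proof.
move=> tt /=; case: pickP => [t' /andP[tt' /eqP e]|/(_ t)]; last by rewrite tt eqxx.
by rewrite (glueI tt' tt e).
Qed.

Section Copy.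
Variables (i : 'I_r) (f : U -> V + J * M).
Hypotheses (fI : injective f) (fE : forall u v, h u v -> colour_class attached attached_colour i (f u) (f v)).

Lemma copy_interior u j m : f u = inr (j, m) -> ~~ terminal m.
Proof.
move=> fu; have [v [_ [_ /fE/andP[+ _] _]]] := two_nbrs hW u.
by rewrite fu /=; case: (f v) => [a|[j' m']]; [case/andP | case/and4P].
Qed.

Definition inside j (P : pred M) u :=
  if f u is inr (j', m) then (j' == j) && P m else false.

(* A part of the interior of a gadget that [h]-edges leave only through two adjacent terminals
   captures the whole copy of [h]. *)
Lemma copy_side j d1 d2 (P : pred M) u0 :
  terminal d1 -> terminal d2 -> N d1 d2 -> cN j d1 d2 = cW (glue j d1) (glue j d2) ->
  inside j P u0 ->
  (forall u v, h u v -> inside j P u ->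
     f v \notin [set inl (glue j d1); inl (glue j d2)] -> inside j P v) ->
  False.
Proof.
have [[NI NC] _ _ _ _] := gadget; have [cNC cNN] := cNg j; have [cWC _] := cWg.
move=> t1 t2 N12 c12 Pu0 cl.
have [[hI hC] _ _] := hW.
pose S := [set u | f u \in [set inl (glue j d1); inl (glue j d2)]].
have S3 : #|S| < 3.
  by apply: leq_ltn_trans (card_preim_inj _ fI) _; rewrite cards2; case: (_ != _).
have all_in v : v \notin S -> inside j P v.
  have u0S : u0 \notin S by move: Pu0; rewrite /inside !inE; case: (f u0).
  move=> vS; apply: (closed_all hW S3 _ u0S vS Pu0) => u w huw _ wS Pu.
  by apply: cl huw Pu _; move: wS; rewrite !inE.
(* Projection of the copy to the gadget, where the edge [d1 d2] exists and has the same colour as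
   its image in [W]. *)
pose g u := match f u with inr (_, m) => m | inl a => if a == glue j d1 then d1 else d2 end.
have gP u : [\/ f u = inr (j, g u) /\ ~~ terminal (g u),
    f u = inl (glue j d1) /\ g u = d1 | f u = inl (glue j d2) /\ g u = d2].
  have [|/all_in] := boolP (u \in S).
    rewrite !inE /g => /orP[]/eqP ->; first by rewrite eqxx; apply: Or32.
    have nd : d2 != d1 by apply: contraTneq N12 => ->; rewrite NI.
    by case: eqP => [/(glueI t2 t1) e|_]; [rewrite e eqxx in nd | apply: Or33].
  rewrite /inside /g; case fu: (f u) => [//|[j' m]] /andP[/eqP jj _]; apply: Or31.
  by rewrite jj; split=> //; apply: copy_interior fu.
have gI : injective g.
  move=> u v e; apply: fI; move: e.
  case: (gP u) => [[-> nu]|[-> eu]|[-> eu]]; case: (gP v) => [[-> nv]|[-> ev]|[-> ev]] e //.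
  - by rewrite e.
  - by case/negP: nu; rewrite e ev.
  - by case/negP: nu; rewrite e ev.
  - by case/negP: nv; rewrite -e eu.
  - by rewrite -eu e ev.
  - by case/negP: nv; rewrite -e eu.
  - by rewrite -ev -e eu.
apply: cNN; exists i, g; split=> // u v huv.
have mixed a b d : terminal d -> h a b -> f a = inl (glue j d) -> f b = inr (j, g b) ->
    ~~ terminal (g b) -> N d (g b) && (cN j d (g b) == i).
  move=> td hab fa fb nb; have := fE hab; rewrite /colour_class fa fb attached_colour_mixed //.
  case/andP=> /= /andP[_ /existsP[t /and3P[tt /eqP e Ntb]]] ->.
  by rewrite -(glueI tt td e) Ntb.
have guv : g u != g v by apply: contraTneq huv => /gI ->; rewrite hI.
rewrite /colour_class.
have [[fu nu]|[fu eu]|[fu eu]] := gP u; have [[fv nv]|[fv ev]|[fv ev]] := gP v.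
- have := fE huv; rewrite /colour_class fu fv /= !eqxx.
  by case/andP=> /and4P[_ _ _ ->] ->.
- by rewrite NC cNC ev; apply: mixed t1 _ fv fu nu; rewrite hC.
- by rewrite NC cNC ev; apply: mixed t2 _ fv fu nu; rewrite hC.
- by rewrite eu; apply: mixed t1 huv fu fv nv.
- by rewrite eu ev eqxx in guv.
- by have := fE huv; rewrite /colour_class fu fv eu ev N12 c12 => /andP[_ ->].
- by rewrite eu; apply: mixed t2 huv fu fv nv.
- by have := fE huv; rewrite /colour_class fu fv eu ev NC N12 cNC c12 cWC => /andP[_ ->].
- by rewrite eu ev eqxx in guv.
Qed.

(** A copy within [W] contradicts [cWg]. Otherwise some gadget contains an interior vertex of it; by
    separation, the interior vertices reached from the first terminal pair border only that pair,
    and the remaining ones only the second, so [copy_side] applies to one of the two parts. *)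
Lemma no_copy : False.
Proof.
have [[NI NC] [Na Nb] _ _ sep] := gadget.
have [t1 t2 t3 t4] := terminals.
have [[j [m0 [u0 fu0]]]|nI] := classic (exists j m u, f u = inr (j, m)); last first.
  have [_ cWN] := cWg.
  have inlf u : exists a, f u = inl a.
    by case fu: (f u) => [a|[j m]]; [exists a | case: nI; exists j, m, u].
  have [g gE] := fin_all_exists inlf.
  apply: cWN; exists i, g; split=> [u v e|u v /fE]; first by apply: fI; rewrite !gE e.
  by rewrite /colour_class !gE.
set A := [set a1; a2] in sep *; set B := [set b1; b2] in sep *.
pose Z := [set m | inr (j, m) \in [set f u | u : U]].
have Zs : #|Z| <= #|U|.
  have jI : injective (fun m => inr (j, m) : V + J * M) by move=> ? ? [].
  exact: leq_trans (card_preim_inj _ jI) (leq_imset_card _ _).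
pose X := (Z :|: A :|: B) :\: (A :&: B).
pose R := [rel u v | N u v && (u \in X) && (v \in X)].
have nAB p q : p \in A :\: B -> q \in B :\: A -> ~~ connect R p q by apply: sep.
pose C m := [exists p in A :\: B, connect R p m].
have XZ u m : f u = inr (j, m) -> m \in X.
  move=> fu; have := copy_interior fu; rewrite /terminal in_setU negb_or => /andP[mA mB].
  rewrite in_setD in_setI (negPf mA) /= in_setU in_setU.
  have -> // : m \in Z by rewrite inE -fu imset_f.
have XA m : m \in A :\: B -> m \in X.
  by rewrite !in_setD in_setI !in_setU => /andP[/negPf -> ->]; rewrite !orbT.
have XB m : m \in B :\: A -> m \in X.
  by rewrite !in_setD in_setI !in_setU => /andP[/negPf -> ->]; rewrite !orbT.
have Cstep m m' : N m m' -> m \in X -> m' \in X -> C m -> C m'.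
  move=> Nmm mX mX' /existsP[p /andP[pA pm]]; apply/existsP; exists p; rewrite pA /=.
  by apply: connect_trans pm (connect1 _); rewrite /= Nmm mX.
have CA m : m \in A :\: B -> C m by move=> mA; apply/existsP; exists m; rewrite mA connect0.
have CB m : m \in B :\: A -> ~~ C m.
  by move=> mB; apply/negP => /existsP[p /andP[pA]]; apply/negP/nAB.
have step (P : pred M) (D : {set M}) d1 d2 :
    (forall m m', N m m' -> m \in X -> m' \in X -> P m -> P m') ->
    (forall t, terminal t -> t \notin D -> t \in X /\ ~~ P t) -> D = [set d1; d2] ->
    forall u v, h u v -> inside j P u ->
      f v \notin [set inl (glue j d1); inl (glue j d2)] -> inside j P v.
  move=> Pstep PD DE u v huv; rewrite /inside.
  case fu: (f u) => [//|[j' m]] /andP[/eqP jj Pm]; subst j'.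
  have /andP[+ _] := fE huv; rewrite fu; case fv: (f v) => [a|[j' m']] /=.
    case/andP=> _ /existsP[t /and3P[tt /eqP <- Ntm]].
    rewrite !inE => ntD.
    have tD : t \notin D.
      by rewrite DE !inE; apply: contra ntD => /orP[]/eqP ->; rewrite eqxx ?orbT.
    have [tX /negP[]] := PD t tt tD; apply: (Pstep m) => //; first by rewrite NC.
    exact: XZ fu.
  case/and4P=> /eqP jj _ _ Nmm _; subst j'.
  by rewrite eqxx; apply: Pstep Nmm (XZ _ _ fu) (XZ _ _ fv) Pm.
have [Cm0|nCm0] := boolP (C m0).
  apply: (@copy_side j a1 a2 C u0 t1 t2 Na (cA j)); first by rewrite /inside fu0 eqxx.
  apply: (step C A) => // t; rewrite /terminal in_setU => tAB tA.
  have tBA : t \in B :\: A by rewrite in_setD tA; move: tAB; rewrite (negPf tA).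
  by split; [apply: XB | apply: CB].
apply: (@copy_side j b1 b2 (predC C) u0 t3 t4 Nb (cB j)); first by rewrite /inside fu0 eqxx.
apply: (step (predC C) B) => // [m m' Nmm mX mX' /= nC|t].
  by apply: contra nC; apply: Cstep => //; rewrite NC.
rewrite /terminal in_setU => tAB tB.
have tAB' : t \in A :\: B by rewrite in_setD tB; move: tAB; rewrite (negPf tB) orbF.
by split; [apply: XA | rewrite /= negbK; apply: CA].
Qed.

End Copy.

Lemma attached_colour_good : good h attached attached_colour.
Proof.
split; first exact: attached_colour_sym.
by move=> [i [f [fI fE]]]; exact: no_copy fI fE.
Qed.

End Colouring.

(** Both edges of a gadget get distinct colours, so a permutation of the colours fits its colouring
    to that of [W]. *)
Lemma attached_colourable (cW : V -> V -> 'I_r) :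
  good h W cW ->
  (forall j, cW (glue j a1) (glue j a2) != cW (glue j b1) (glue j b2)) ->
  ~ arrows r h attached.
Proof.
move=> cWg cWn; have [_ _ /not_arrows_good[c cg] cn _] := gadget.
have /fin_all_exists[cN cNP] : forall j, exists cj : M -> M -> 'I_r, [/\ good h N cj,
    cj a1 a2 = cW (glue j a1) (glue j a2) & cj b1 b2 = cW (glue j b1) (glue j b2)].
  move=> j; have /eqP cn' := cn c cg.
  have [s [sI sa sb]] := inj_two_points cn' (cWn j).
  by exists (fun u v => s (c u v)); split=> //; apply: good_recolour.
apply/not_arrows_good; exists (attached_colour cW cN (c a1 a2)).
by apply: attached_colour_good => // j; have [] := cNP j.
Qed.

End Attach.

(** * Gadgets with distant edges *)

Section Caterpillar.
Variables (n r : nat).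

(* The vertices [(j, ord0)] form a path, and [(j, k)] with [k != ord0] is a leaf attached to [(j, ord0)]. *)
Definition caterpillar : rel ('I_n.+1 * 'I_r.+1) := fun a b =>
  [&& a.2 == ord0, b.2 == ord0 & (a.1.+1 == b.1 :> nat) || (b.1.+1 == a.1 :> nat)]
  || (a.1 == b.1) && ((a.2 == ord0) != (b.2 == ord0)).

(** The larger second component: path edges get [ord0] and the leaf edge to [(j, k)] gets [k]. *)
Definition caterpillar_colour (a b : 'I_n.+1 * 'I_r.+1) : 'I_r.+1 :=
  if a.2 < b.2 then b.2 else a.2.

Lemma caterpillar_sgraph : is_sgraph caterpillar.
Proof.
split=> [a|a b]; rewrite /caterpillar; first by rewrite !eqxx; lia.
rewrite [b.1 == a.1]eq_sym; case: (a.2 == ord0); case: (b.2 == ord0) => //=.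
by rewrite !andbF !orbF orbC.
Qed.

Lemma caterpillar_level a b : caterpillar a b -> a.1 <= b.1.+1.
Proof. by case/orP=> [/and3P[_ _ /orP[]/eqP]|/andP[/eqP -> _]]; lia. Qed.

Lemma caterpillar_colour_leaf j (k : 'I_r.+1) : caterpillar_colour (j, ord0) (j, k) = k.
Proof. by rewrite /caterpillar_colour /=; case: ltnP => // ?; apply/val_inj => /=; lia. Qed.

(** Orders the vertices so that each has at most one neighbour of no larger rank: the preceding path
    vertex, or the one carrying the leaf. *)
Definition rank (a : 'I_n.+1 * 'I_r.+1) := a.1.*2 + (a.2 != ord0).

Lemma caterpillar_parent a b b' : caterpillar a b -> caterpillar a b' ->
  rank b <= rank a -> rank b' <= rank a -> b = b'.
Proof.
have key c : caterpillar a c -> rank c <= rank a ->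
    c.2 = ord0 /\ c.1 = (if a.2 == ord0 then a.1.-1 else a.1) :> nat.
  rewrite /rank; case/orP=> [/and3P[/eqP -> /eqP ->]|/andP[/eqP ->]].
    by rewrite eqxx => /orP[]/eqP; split=> //; lia.
  by case: (eqVneq a.2 ord0) => a0; case: (eqVneq c.2 ord0) => c0 //= _; lia.
move=> ab ab' rb rb'; have [b2 b1] := key b ab rb; have [b2' b1'] := key b' ab' rb'.
rewrite [b]surjective_pairing [b']surjective_pairing b2 b2'; congr (_, _).
by apply/val_inj; rewrite /= b1 b1'.
Qed.

(** A vertex of largest rank in a copy of [h] would have two neighbours of no larger rank. *)
Lemma caterpillar_good (U : finType) (h : rel U) :
  well_connected h -> good h caterpillar caterpillar_colour.
Proof.
move=> hW; split=> [a b|[i [f [fI fE]]]].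
  by rewrite /caterpillar_colour; case: ltngtP => // /val_inj.
have [u0 _] := some_edge hW.
have [u _ umax] := @arg_maxnP U u0 xpredT (fun u => rank (f u)) isT.
have [v [w [/eqP vw /fE/andP[huv _] /fE/andP[huw _]]]] := two_nbrs hW u.
by apply: vw; apply: fI; apply: caterpillar_parent huv huw (umax _ _) (umax _ _).
Qed.

End Caterpillar.

(* At every inner vertex of the path the leaf edges have all colours but one, so that both path edges
   get the remaining colour: the colour of the first edge is transported along the path. *)
Lemma far_gadget r (U : finType) (h : rel U) :
  1 < r -> well_connected h ->
  exists (T : finType) (e : rel T) (a1 a2 b1 b2 : T),
    neq_gadget r h e a1 a2 b1 b2 /\ [/\ a1 != b1, a1 != b2, a2 != b1 & a2 != b2].
Proof.
case: r => [|[|r]] // r1 hW.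
have [M [N [x [p [q gad]]]]] := star_gadget r1 hW.
have [[NI NC] [Nxp Nxq] /not_arrows_good[c0 c0g] neq _] := gad.
have xp : x != p by apply: contraTneq Nxp => ->; rewrite NI.
have xq : x != q by apply: contraTneq Nxq => ->; rewrite NI.
have pq : p != q by apply/eqP => e; apply: (neq c0 c0g); rewrite e.
(* There are [#|U|.+1] levels strictly between 1 and [n], so [#|U|] vertices miss one of them. *)
pose n := #|U|.+3; pose V := ('I_n.+1 * 'I_r.+2)%type.
pose W : rel V := @caterpillar n r.+1; pose cW := @caterpillar_colour n r.+1.
(* A gadget is attached to every two adjacent edges of different colours. *)
pose ok (t : V * V * V) :=
  [&& W t.1.1 t.1.2, W t.1.1 t.2 & cW t.1.1 t.1.2 != cW t.1.1 t.2].
pose J := {t : V * V * V | ok t}.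
pose glue (t : J) m := if m == x then (val t).1.1 else if m == p then (val t).1.2 else (val t).2.
have gx t : glue t x = (val t).1.1 by rewrite /glue eqxx.
have gp t : glue t p = (val t).1.2 by rewrite /glue eq_sym (negPf xp) eqxx.
have gq t : glue t q = (val t).2.
  by rewrite /glue eq_sym (negPf xq) eq_sym (negPf pq).
have WS : is_sgraph W := @caterpillar_sgraph n r.+1; have [WI WC] := WS.
have okP (t : J) : ok (val t) := valP t.
have termE m : terminal x p x q m -> [\/ m = x, m = p | m = q].
  by rewrite /terminal !inE => /orP[]/orP[]/eqP ->; [apply: Or31|apply: Or32|apply: Or31|apply: Or33].
have glueI t m m' : terminal x p x q m -> terminal x p x q m' -> glue t m = glue t m' -> m = m'.
  have /and3P[W1 W2 n12] := okP t.
  have d1 : (val t).1.1 <> (val t).1.2 by move=> e; rewrite -e WI in W1.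
  have d2 : (val t).1.1 <> (val t).2 by move=> e; rewrite -e WI in W2.
  have d3 : (val t).1.2 <> (val t).2 by move=> e; rewrite e eqxx in n12.
  by case/termE=> ->; case/termE=> ->; rewrite ?gx ?gp ?gq //; move/esym.
have gW1 t : W (glue t x) (glue t p) by rewrite gx gp; have /and3P[] := okP t.
have gW2 t : W (glue t x) (glue t q) by rewrite gx gq; have /and3P[] := okP t.
have gWn t : cW (glue t x) (glue t p) != cW (glue t x) (glue t q).
  by rewrite gx gp gq; have /and3P[] := okP t.
pose e := attached N x p x q W glue.
have eN : ~ arrows r.+2 h e.
  by apply: (attached_colourable hW gad glueI _ gWn); apply: caterpillar_good.
have cneq (c : V + J * M -> V + J * M -> 'I_r.+2) a b b' : good h e c ->
    W a b -> W a b' -> cW a b <> cW a b' -> c (inl a) (inl b) <> c (inl a) (inl b').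
  move=> cg ab ab' /eqP cab; have okt : ok (a, b, b') by rewrite /ok /= ab ab'.
  have := attached_neq gad glueI WS gW1 gW2 (j := exist ok (a, b, b') okt) cg.
  by rewrite !gx !gp !gq.
(* The second distinguished edge joins [path n] to the leaf [tip]; it must differ from the last path
   edge. *)
pose path j : V := (inord j, ord0); pose tip : V := (inord n, inord 1).
have path1 j : j <= n -> (path j).1 = j :> nat by move=> jn; rewrite inordK.
have Wpath j : j < n -> W (path j) (path j.+1).
  by move=> jn; rewrite /W /caterpillar !path1 ?eqxx //= 1?ltnW.
have Wtip : W (path n) tip.
  have t0 : (inord 1 == ord0 :> 'I_r.+2) = false by rewrite -val_eqE /= inordK.
  by rewrite /W /caterpillar /= t0 !eqxx orbT.
have cpath (c : V + J * M -> V + J * M -> 'I_r.+2) j : good h e c -> j < n ->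
    c (inl (path j)) (inl (path j.+1)) = c (inl (path 0)) (inl (path 1)).
  move=> cg; elim: j => // j IH jn; rewrite -IH; last exact: ltnW.
  set a := path j.+1; pose leaf k : V := (inord j.+1, k).
  pose nb (k : 'I_r.+2) : V := if k == ord0 then path j else leaf k.
  have Wnb k : W a (nb k).
    rewrite /nb; case: eqP => [_|/eqP k0]; first by rewrite WC Wpath // ltnW.
    by rewrite /W /caterpillar /= eqxx (negPf k0) eqxx orbT.
  have cnb k : cW a (nb k) = k.
    rewrite /nb; case: eqP => [->|_]; first by rewrite /cW /caterpillar_colour.
    exact: caterpillar_colour_leaf.
  have FI : injective (fun k => c (inl a) (inl (nb k))).
    move=> k k' ck; apply/eqP; apply: contraT => /eqP kk.
    by case: (cneq c _ _ _ cg (Wnb k) (Wnb k') _ ck); rewrite !cnb.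
  have /codomP[k ck] := injF_onto FI (c (inl a) (inl (path j.+2))).
  have [k0|/eqP k0] := eqVneq k ord0; last first.
    case: (cneq c _ _ _ cg (Wpath _ jn) (Wnb k) _ ck).
    by rewrite cnb => e0; apply: k0; rewrite -e0 /cW /caterpillar_colour.
  by rewrite ck k0 /nb eqxx; have [cC _] := cg; rewrite cC.
exists _, e, (inl (path 0)), (inl (path 1)), (inl (path n)), (inl tip); split; last first.
  have inj_path i j : i <= n -> j <= n -> i != j -> path i != path j.
    move=> iN jN ij; apply: contraNneq ij => eij.
    by rewrite -(path1 i iN) -(path1 j jN) eij.
  have ptip i : path i != tip.
    by apply/eqP => -[_ /(congr1 val)] /=; rewrite inordK.
  have inl_neq (a b : V) : a != b -> (inl a : V + J * M) != inl b.
    by move=> /eqP ab; apply/eqP => -[].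
  by split; apply: inl_neq => //; apply: inj_path.
split=> //; first exact: (attached_sgraph gad glue WS).
- split; first exact: Wpath.
  exact: Wtip.
- move=> c cg; rewrite -(cpath c n.-1 cg) //=; have [cC _] := cg; rewrite cC.
  apply: (cneq c _ _ _ cg); first by rewrite WC Wpath.
    exact: Wtip.
  have -> : cW (path n) (path n.-1) = ord0 by rewrite /cW /caterpillar_colour.
  have -> : cW (path n) tip = inord 1 by apply: caterpillar_colour_leaf.
  by move/(congr1 val); rewrite /= inordK.
(* Interior vertices of a gadget take the level of its centre, so a level changes by at most one
   along an edge and no walk crosses an empty level. *)
pose lev (u : V + J * M) : nat := match u with inl a => a.1 | inr (t, _) => (val t).1.1.1 end.
have lev_step u v : e u v -> lev u <= (lev v).+1.
  have lev_glue t m : terminal x p x q m ->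
      (glue t m).1 <= (val t).1.1.1.+1 /\ (val t).1.1.1 <= (glue t m).1.+1.
    have /and3P[W1 W2 _] := okP t.
    case/termE=> ->; rewrite ?gx ?gp ?gq; split=> //; apply: caterpillar_level => //;
    by rewrite -/(W _ _) WC.
  case: u v => [a|[t m]] [b|[t' m']] /=.
  - exact: caterpillar_level.
  - by case/andP=> _ /existsP[y /and3P[ty /eqP <- _]]; have [] := lev_glue t' y ty.
  - by case/andP=> _ /existsP[y /and3P[ty /eqP <- _]]; have [] := lev_glue t y ty.
  - by case/and4P=> /eqP -> _ _ _.
move=> Z a b Zs; set A := [set _; _]; set B := [set _; _] => aA bB /=; set X := _ :\: _.
have levA u : u \in A -> lev u <= 1.
  by rewrite !inE => /orP[]/eqP ->; rewrite /lev path1.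
have levB u : u \in B -> lev u = n.
  by rewrite !inE => /orP[]/eqP ->; rewrite /lev ?path1 //= inordK.
have [l lZ] : exists l : 'I_#|U|.+1, forall z, z \in Z -> lev z <> l.+2.
  have /subsetPn[l _ lZ] : ~~ ([set: 'I_#|U|.+1] \subset [set inord (lev z).-2 | z in Z]).
    apply/negP => /subset_leq_card; rewrite cardsT card_ord ltnNge => /negP[].
    exact: leq_trans (leq_imset_card _ _) Zs.
  exists l => z zZ zl; case/negP: lZ; apply/imsetP; exists z => //.
  by rewrite zl /=; apply/val_inj; rewrite /= inordK.
have levX u : u \in X -> lev u <> l.+2.
  rewrite in_setD => /andP[_]; rewrite 2!in_setU -orbA => /or3P[/lZ//|/levA|/levB ->]; first lia.
  by rewrite /n; have := ltn_ord l; lia.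
apply/negP => /(connect_invariant (P := fun u => lev u < l.+2)) H.
suff : lev b < l.+2.
  by move: bB; rewrite in_setD => /andP[_ /levB ->]; rewrite /n; have := ltn_ord l; lia.
apply: H => [u v ul /andP[/andP[/= euv _] /levX /eqP vl]|].
  have [_ eC] := attached_sgraph gad glue WS.
  by have evu : e v u by [rewrite /e eC]; rewrite ltn_neqAle vl; apply: leq_trans (lev_step v u evu) ul.
by move: aA; rewrite in_setD => /andP[_ /levA]; lia.
Qed.

(** * Realising the colour pattern *)

Unset Implicit Arguments.

Theorem theorem2p2 (r : nat) (U : finType) (h : rel U) (V : finType)
  (Gs : 'I_r -> rel V) :
  2 <= r ->
  is_sgraph h ->
  (k_connected 3 h \/ is_K3 h) ->
  colour_pattern Gs ->
  pattern_H_free h Gs ->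
  exists (T : finType) (e : rel T) (phi : V -> T),
    [/\ is_sgraph e,
        injective phi,
        (forall x y, e (phi x) (phi y) = pattern_union Gs x y),
        ~ arrows r h e
      & forall c : T -> T -> 'I_r, is_colouring c -> ~ has_mono_copy h e c ->
          exists sigma : 'I_r -> 'I_r, injective sigma /\
            forall i x y, Gs i x y -> c (phi x) (phi y) = sigma i].
Proof.
move=> r1 hS hconn [GsS GsD] Gfree.
have hW : well_connected h.
  case: hconn => [[U3 conn]|[U3 K3]]; first by split=> //; apply: ltnW.
  split=> // [|S _ x y xS yS]; first by rewrite U3.
  have [->|xy] := eqVneq x y; first exact: connect0.
  by apply: connect1; rewrite /= K3 xy xS.
have [M [N [a1 [a2 [b1 [b2 [gad [ab11 ab12 ab21 ab22]]]]]]]] := far_gadget r1 hW.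
have [[NI _] [Na Nb] _ _ _] := gad.
have a12 : a1 != a2 by apply: contraTneq Na => ->; rewrite NI.
have b12 : b1 != b2 by apply: contraTneq Nb => ->; rewrite NI.
pose B := (V + 'I_r * bool)%type.
(* The edge [inr (i, false)], [inr (i, true)] is a reference edge for the colour of [Gs i]. *)
pose W : rel B := fun u v => match u, v with
  | inl x, inl y => pattern_union Gs x y
  | inr (i, b), inr (j, b') => (i == j) && (b != b')
  | _, _ => false end.
pose i0 : 'I_r := Ordinal (ltnW r1).
pose cW (u v : B) : 'I_r := match u, v with
  | inl x, inl y => odflt i0 [pick i | Gs i x y]
  | inr (i, _), inr (j, _) => if i == j then i else i0
  | _, _ => i0 end.
have WS : is_sgraph W.
  split=> [[x|[i b]]|[x|[i b]] [y|[j b']]] //=.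
  - by apply/existsP => -[i]; have [-> ] := GsS i.
  - by rewrite !eqxx.
  - by apply: eq_existsb => i; have [_ ->] := GsS i.
  - by rewrite eq_sym [b == b']eq_sym.
have cWGs i x y : Gs i x y -> cW (inl x) (inl y) = i.
  move=> Gi /=; case: pickP => [j Gj|/(_ i)]; last by rewrite Gi.
  by apply/eqP; apply: contraT => ji; case: (GsD j i x y ji Gj Gi).
have cWg : good h W cW.
  split=> [[x|[i b]] [y|[j b']]|[i [f [fI fE]]]] //=.
  - by congr odflt; apply: eq_pick => i; have [_ ->] := GsS i.
  - by rewrite eq_sym; case: eqP => // ->.
  have [u0 [_ _]] := some_edge hW.
  (* The index of the reference edge containing [f u] is constant on a copy of [h]; a single edge is
     too small for two neighbours, so the copy lies in [V]. *)
  pose ref u := if f u is inr (j, _) then Some j else None.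
  have refE u v : h u v -> ref u = ref v.
    move=> /fE /andP[]; rewrite /ref.
    by case: (f u) (f v) => [x|[j b]] [y|[j' b']] //= /andP[/eqP ->].
  have ref_const u v : ref u = ref v.
    apply/eqP; apply: (closed_all hW (S := set0) (P := fun w => ref u == ref w) _ _ (u := u));
      rewrite ?cards0 ?inE //.
    by move=> a b /refE ->.
  case ru0: (ref u0) => [j|].
    have [v [w [/eqP vw /fE/andP[+ _] /fE/andP[+ _]]]] := two_nbrs hW u0.
    move: ru0; rewrite /ref; case: (f u0) => [//|[j' b]] _.
    case fv: (f v) => [//|[jv bv]] /= /andP[/eqP ejv nbv].
    case fw: (f w) => [//|[jw bw]] /= /andP[/eqP ejw nbw].
    apply: vw; apply: fI; rewrite fv fw -ejv -ejw.
    by move: nbv nbw; case: (b) (bv) (bw) => [] [] [].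
  have inlf u : exists x, f u = inl x.
    have := ref_const u u0; rewrite ru0 /ref; case: (f u) => [x _|[]//]; by exists x.
  have [g gE] := fin_all_exists inlf.
  apply: (Gfree i); exists g; split=> [u v e|u v huv].
    by apply: fI; rewrite !gE e.
  have := fE _ _ huv; rewrite /colour_class !gE => /andP[/existsP[j Gj] /eqP].
  by rewrite (cWGs _ _ _ Gj) => <-.
(* The edges considered include the reference edges themselves, which makes [sigma] injective. *)
pose ok (t : B * B * 'I_r) := W t.1.1 t.1.2 && (cW t.1.1 t.1.2 != t.2).
pose J := {t : B * B * 'I_r | ok t}.
pose glue (t : J) m : B := if m == a1 then (val t).1.1 else if m == a2 then (val t).1.2
  else inr ((val t).2, m == b2).
have g1 t : glue t a1 = (val t).1.1 by rewrite /glue eqxx.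
have g2 t : glue t a2 = (val t).1.2 by rewrite /glue eq_sym (negPf a12) eqxx.
have g3 t : glue t b1 = inr ((val t).2, false).
  by rewrite /glue eq_sym (negPf ab11) eq_sym (negPf ab21) (negPf b12).
have g4 t : glue t b2 = inr ((val t).2, true).
  by rewrite /glue eq_sym (negPf ab12) eq_sym (negPf ab22) eqxx.
have okP (t : J) : ok (val t) := valP t.
have far (t : J) b : (val t).1.1 <> inr ((val t).2, b) /\ (val t).1.2 <> inr ((val t).2, b).
  have /andP[] := okP t; case: (val t).1.1 => [x|[i b']]; case: (val t).1.2 => [y|[j b'']] //=.
  by case/andP=> /eqP -> _; rewrite eqxx => /eqP n; split=> -[e _]; apply: n.
have glueI t m m' : terminal a1 a2 b1 b2 m -> terminal a1 a2 b1 b2 m' ->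
    glue t m = glue t m' -> m = m'.
  have d12 : (val t).1.1 <> (val t).1.2.
    by have /andP[Wt _] := okP t; move=> e; rewrite e (proj1 WS) in Wt.
  have termE x : terminal a1 a2 b1 b2 x -> [\/ x = a1, x = a2, x = b1 | x = b2].
    by rewrite /terminal !inE => /orP[]/orP[]/eqP ->; [apply: Or41|apply: Or42|apply: Or43|apply: Or44].
  have [f1 f2] := far t false; have [f3 f4] := far t true.
  by case/termE=> ->; case/termE=> ->; rewrite ?g1 ?g2 ?g3 ?g4 // => /esym.
have gW1 t : W (glue t a1) (glue t a2) by rewrite g1 g2; have /andP[] := okP t.
have gW2 t : W (glue t b1) (glue t b2) by rewrite g3 g4 /= eqxx.
have gWn t : cW (glue t a1) (glue t a2) != cW (glue t b1) (glue t b2).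
  by rewrite g1 g2 g3 g4 /= eqxx; have /andP[] := okP t.
pose e := attached N a1 a2 b1 b2 W glue.
exists _, e, (fun x => inl (inl x)); split.
- exact: (attached_sgraph gad glue WS).
- by move=> x y [].
- by [].
- exact: (attached_colourable hW gad glueI cWg gWn).
move=> c cC cN; have cg : good h e c by [].
have neq u v i : W u v -> cW u v != i ->
    c (inl u) (inl v) <> c (inl (inr (i, false))) (inl (inr (i, true))).
  move=> Wuv ni; have okt : ok (u, v, i) by rewrite /ok /= Wuv.
  have := attached_neq gad glueI WS gW1 gW2 (j := exist ok (u, v, i) okt) cg.
  by rewrite g1 g2 g3 g4.
pose sigma i := c (inl (inr (i, false))) (inl (inr (i, true))).
have sI : injective sigma.
  move=> i j sij; apply/eqP; apply: contraT => ij.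
  by case: (neq (inr (i, false)) (inr (i, true)) j) => //=; rewrite !eqxx.
exists sigma; split=> // i x y Gi.
(* As [sigma] is onto, the edge has the colour of some reference edge [j], and a gadget excludes
   every [j] other than [i]. *)
have /codomP[j cj] := injF_onto sI (c (inl (inl x)) (inl (inl y))).
rewrite cj; congr sigma; apply/eqP; apply: contraT => ji.
case: (neq (inl x) (inl y) j) => //; first by apply/existsP; exists i.
by rewrite (cWGs _ _ _ Gi) eq_sym.
Qed.
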